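(* Let $n,k\ge1$, let $V=\mathrm{Span}_{\mathbb{C}}\{v_1,\dots,v_n\}$ be the permutation module of the symmetric group $S(n)$, and let $M=\mathrm{Span}_{\mathbb{C}}\{m_1,\dots,m_d\}$ be any $\mathbb{C}S(n)$-module. There is a $\mathbb{C}$-algebra homomorphism $$\psi_{n,k}^{(M)}:\mathcal{A}_{2k}^{\mathrm{aff}}\to\mathrm{End}_{S(n)}(M\otimes V^{\otimes k})$$ defined on the generators as follows, where $m\in\{m_1,\dots,m_d\}$, $\bm a=(a_1,\dots,a_k)\in[n]^k$, $v_{\bm a}=v_{a_1}\otimes\cdots\otimes v_{a_k}$, and everything is extended $\mathbb{C}$-linearly: $$e_{2i-1}\cdot(m\otimes v_{\bm a})=\sum_{b=1}^n m\otimes v_{a_1}\otimes\cdots\otimes v_{a_{i-1}}\otimes v_b\otimes v_{a_{i+1}}\otimes\cdots\otimes v_{a_k},$$ $$e_{2i}\cdot(m\otimes v_{\bm a})=\delta_{a_i,a_{i+1}}\,m\otimes v_{\bm a},$$ $$\tau_{2i}\cdot(m\otimes v_{\bm a})=\varepsilon_{a_i,a_{i+1}}\,(a_i,a_{i+1})(m\otimes v_{a_1}\otimes\cdots\otimes v_{a_{i-1}})\otimes v_{a_i}\otimes\cdots\otimes v_{a_k},$$ $$\tau_{2i+1}\cdot(m\otimes v_{\bm a})=\varepsilon_{a_i,a_{i+1}}\,(a_i,a_{i+1})(m\otimes v_{a_1}\otimes\cdots\otimes v_{a_{i+1}})\otimes v_{a_{i+2}}\otimes\cdots\otimes v_{a_k},$$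 $$x_{2i-1}\cdot(m\otimes v_{\bm a})=\sum_{b\in[n],\,b\neq a_i}(b,a_i)(m\otimes v_{a_1}\otimes\cdots\otimes v_{a_{i-1}})\otimes v_{a_i}\otimes\cdots\otimes v_{a_k},$$ $$x_{2i}\cdot(m\otimes v_{\bm a})=\sum_{b\in[n],\,b\neq a_i}(b,a_i)(m\otimes v_{a_1}\otimes\cdots\otimes v_{a_{i}})\otimes v_{a_{i+1}}\otimes\cdots\otimes v_{a_k},$$ $$z_l\cdot(m\otimes v_{\bm a})=(Z_{n,l}\,m)\otimes v_{\bm a}.$$
   Context: $[n]=\{1,\dots,n\}$. $S(n)$ acts on $V$ by $\pi v_a=v_{\pi(a)}$ and diagonally on tensor products of modules; $\mathrm{End}_{S(n)}$ denotes endomorphisms commuting with $S(n)$. $(a,b)\in S(n)$ denotes the transposition of $a\ne b$ and acts diagonally on the bracketed tensor factors; $\delta$ is the Kronecker delta and $\varepsilon_{a,b}=1-\delta_{a,b}$ (terms with $\varepsilon=0$ are zero). $T_{n,b}=\sum_{a\in[n]\setminus\{b\}}(a,b)\in\mathbb{C}S(n)$ and $Z_{n,l}=\sum_{b\in[n]}T_{n,b}^l$ for $l\ge0$ (so $Z_{n,0}=n$). **Affine partition algebra.** $\mathcal{A}_{2k}^{\mathrm{aff}}$ is the unital associative $\mathbb{C}$-algebra with generators $\tau_i$ ($2\le i\le 2k-1$), $e_j$ ($1\le j\le 2k-1$), $x_r$ ($1\le r\le 2k$), $z_l$ ($l\in\mathbb{Z}_{\ge0}$) and the following relations (where no range is given,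 for all indices for which all generators involved are defined): (1) $\tau_{2i}^2=1-e_{2i}$, $\tau_{2i+1}^2=1-e_{2i}$ for $i\in[k-1]$. (2) $\tau_{2i+1}\tau_{2j}=\tau_{2j}\tau_{2i+1}$ for $j\ne i+1$; $\tau_{2i+1}\tau_{2j+1}=\tau_{2j+1}\tau_{2i+1}$ and $\tau_{2i}\tau_{2j}=\tau_{2j}\tau_{2i}$ for $j\ne i\pm1$; $s_is_{i+1}s_i=s_{i+1}s_is_{i+1}$ for $i\in[k-2]$, where $s_j:=\tau_{2j}\tau_{2j+1}+e_{2j}$. (3) $e_{2i-1}^2=z_0e_{2i-1}$ ($i\in[k]$); and for $i\in[k-1]$: $e_{2i}^2=e_{2i}$, $\tau_{2i+1}e_{2i}=e_{2i}\tau_{2i+1}=0$, $\tau_{2i}e_{2i}=e_{2i}\tau_{2i}=0$, $\tau_{2i}e_{2i-1}e_{2i+1}=\tau_{2i+1}e_{2i-1}e_{2i+1}$, $e_{2i+1}e_{2i-1}\tau_{2i}=e_{2i+1}e_{2i-1}\tau_{2i+1}$. (4) $e_ie_j=e_je_i$ if $|i-j|\ge2$; $\tau_{2i-1}e_{2j-1}=e_{2j-1}\tau_{2i-1}$ if $j\ne i-1,i$; $\tau_{2i-1}e_{2j}=e_{2j}\tau_{2i-1}$ if $j\ne i$; $\tau_{2i}e_{2j-1}=e_{2j-1}\tau_{2i}$ if $j\neq i,i+1$; $\tau_{2i}e_{2j}=e_{2j}\tau_{2i}$ if $j\ne i-1$. (5) $e_ie_{i+1}e_i=e_i$, $e_{i+1}e_ie_{i+1}=e_{i+1}$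 for $i\in[2k-2]$; $\tau_{2i}e_{2i-1}\tau_{2i}=\tau_{2i+1}e_{2i+1}\tau_{2i+1}$ for $i\in[k-1]$; $\tau_{2i}e_{2i-2}\tau_{2i}=\tau_{2i-1}e_{2i}\tau_{2i-1}$ for $2\le i\le k-1$. (6) $x_ix_j=x_jx_i$; $\tau_ix_j=x_j\tau_i$ for $j\ne i-1,i,i+1$; $e_ix_j=x_je_i$ for $j\ne i,i+1$. (7) $\tau_{2i-2}\tau_{2i}\tau_{2i-2}=\tau_{2i}\tau_{2i-2}\tau_{2i}(1-e_{2i-2})$; $\tau_{2i+1}\tau_{2i-1}\tau_{2i+1}=\tau_{2i-1}\tau_{2i+1}\tau_{2i-1}(1-e_{2i})$; $\tau_{2i-1}\tau_{2i}\tau_{2i-1}=\tau_{2i}-e_{2i-2}\tau_{2i}-\tau_{2i}e_{2i-2}$; $\tau_{2i}\tau_{2i-1}\tau_{2i}=\tau_{2i-1}-e_{2i}\tau_{2i-1}-\tau_{2i-1}e_{2i}$. (8) $x_{2i+1}=\tau_{2i}x_{2i-1}\tau_{2i}+e_{2i}e_{2i-1}\tau_{2i}+\tau_{2i}e_{2i-1}e_{2i}-\tau_{2i}$; $x_{2i+2}=\tau_{2i+1}x_{2i}\tau_{2i+1}+e_{2i}e_{2i+1}\tau_{2i+1}e_{2i+1}e_{2i}+\tau_{2i+1}$; $x_{2i}=\tau_{2i}x_{2i}\tau_{2i}+e_{2i}e_{2i-1}\tau_{2i}+\tau_{2i}e_{2i-1}e_{2i}$; $x_{2i+1}=\tau_{2i+1}x_{2i+1}\tau_{2i+1}+e_{2i}e_{2i+1}\tau_{2i+1}+\tau_{2i+1}e_{2i+1}e_{2i}$.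 (9) $e_i(x_i-x_{i+1})=0=(x_i-x_{i+1})e_i$ for $i\in[2k-1]$. (10) $e_1x_1^le_1=z_le_1$ for $l\ge1$; every $z_l$ ($l\ge0$) is central. *)

(* Defs.v *)
From HB Require Import structures.
From mathcomp Require Import all_boot all_order all_algebra all_fingroup.
From mathcomp Require Import mxrepresentation generic_quotient boolp.

Set Implicit Arguments.
Unset Strict Implicit.
Unset Printing Implicit Defensive.

Import GRing.Theory.

Local Open Scope ring_scope.
Local Open Scope quotient_scope.

(* The unital associative F-algebra presented by generators G and relations rel,
   as the quotient of the formal algebra expressions by the least congruence that
   contains rel and the axioms of unital associative F-algebras. *)

Inductive term (F : comNzRingType) (G : Type) : Type :=
| TGen of G
| TZero
| TOpp of term F G
| TAdd of term F G & term F G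
| TOne
| TMul of term F G & term F G
| TScale of F & term F G.

Arguments TGen {F G} g.
Arguments TZero {F G}.
Arguments TOne {F G}.

Fixpoint tmap (F : comNzRingType) (G H : Type) (f : G -> H) (t : term F G) :
    term F H :=
  match t with
  | TGen g => TGen (f g)
  | TZero => TZero
  | TOpp t => TOpp (tmap f t)
  | TAdd t u => TAdd (tmap f t) (tmap f u)
  | TOne => TOne
  | TMul t u => TMul (tmap f t) (tmap f u)
  | TScale a t => TScale a (tmap f t)
  end.

Declare Scope palg_scope.
Delimit Scope palg_scope with palg.
Bind Scope palg_scope with term.

Notation "0" := TZero : palg_scope.
Notation "1" := TOne : palg_scope.
Notation "t + u" := (TAdd t u) : palg_scope.
Notation "- t" := (TOpp t) : palg_scope.
Notation "t - u" := (TAdd t (TOpp u)) : palg_scope.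
Notation "t * u" := (TMul t u) : palg_scope.
Notation "a *: t" := (TScale a t) : palg_scope.
Notation "t ^+ l" := (iter l (TMul t) TOne) : palg_scope.

Section PresentedAlgebra.
Variables (F : comNzRingType) (G : Type) (rel : term F G -> term F G -> Prop).

HB.instance Definition _ := gen_eqMixin (term F G).
HB.instance Definition _ := gen_choiceMixin (term F G).

Inductive cong : term F G -> term F G -> Prop :=
| cong_rel t u : rel t u -> cong t u
| cong_refl t : cong t t
| cong_sym t u : cong t u -> cong u t
| cong_trans u t w : cong t u -> cong u w -> cong t w
| cong_opp t t' : cong t t' -> cong (- t) (- t')
| cong_add t t' u u' : cong t t' -> cong u u' -> cong (t + u) (t' + u')
| cong_mul t t' u u' : cong t t' -> cong u u' -> cong (t * u) (t' * u')
| cong_scale a t t' : cong t t' -> cong (a *: t) (a *: t')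
| cong_addA t u w : cong (t + (u + w)) (t + u + w)
| cong_addC t u : cong (t + u) (u + t)
| cong_add0 t : cong (0 + t) t
| cong_addN t : cong (- t + t) 0
| cong_mulA t u w : cong (t * (u * w)) (t * u * w)
| cong_mul1l t : cong (1 * t) t
| cong_mul1r t : cong (t * 1) t
| cong_mulDl t u w : cong ((t + u) * w) (t * w + u * w)
| cong_mulDr t u w : cong (t * (u + w)) (t * u + t * w)
| cong_scaleA a b t : cong (a *: (b *: t)) ((a * b)%R *: t)
| cong_scale1 t : cong (1%R *: t) t
| cong_scaleDr a t u : cong (a *: (t + u)) (a *: t + a *: u)
| cong_scaleDl a b t : cong ((a + b)%R *: t) (a *: t + b *: t)
| cong_scaleAl a t u : cong (a *: (t * u)) ((a *: t) * u)
| cong_scaleAr a t u : cong (a *: (t * u)) (t * (a *: u)).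

Definition congb (t u : term F G) : bool := `[< cong t u >].

Lemma congb_equiv : equiv_class_of congb.
Proof.
split.
- by move=> t; apply/asboolP; exact: cong_refl.
- by move=> t u; apply/asboolP/asboolP; exact: cong_sym.
- move=> u t w /asboolP tu /asboolP uw; apply/asboolP; exact: cong_trans tu uw.
Qed.

Canonical congb_equiv_rel := EquivRelPack congb_equiv.

Definition palg : Type := {eq_quot congb_equiv_rel}.
HB.instance Definition _ := Choice.on palg.
HB.instance Definition _ := EqQuotient.on palg.

Definition palg_of (t : term F G) : palg := \pi t.
Definition palg_gen (g : G) : palg := palg_of (TGen g).

Lemma palg_ofP (t u : term F G) : palg_of t = palg_of u <-> cong t u.
Proof.
rewrite /palg_of; split=> [/eqP | tu].
  by rewrite (@pi_eq_quot _ _ palg) => /asboolP.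
by apply/eqP; rewrite (@pi_eq_quot _ _ palg); apply/asboolP.
Qed.

Lemma palg_of_repr (x : palg) : palg_of (repr x) = x.
Proof. exact: reprK. Qed.

Lemma palgW (P : palg -> Prop) : (forall t, P (palg_of t)) -> forall x, P x.
Proof. by move=> Pt x; rewrite -[x]palg_of_repr. Qed.

Lemma cong_repr (t : term F G) : cong (repr (palg_of t)) t.
Proof. by apply/palg_ofP; exact: palg_of_repr. Qed.

Definition palg_opp (x : palg) := palg_of (- repr x).
Definition palg_add (x y : palg) := palg_of (repr x + repr y).
Definition palg_mul (x y : palg) := palg_of (repr x * repr y).
Definition palg_scale (a : F) (x : palg) := palg_of (a *: repr x).

Lemma palg_oppE t : palg_opp (palg_of t) = palg_of (- t).
Proof. by apply/palg_ofP/cong_opp/cong_repr. Qed.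

Lemma palg_addE t u : palg_add (palg_of t) (palg_of u) = palg_of (t + u).
Proof. by apply/palg_ofP; apply: cong_add; exact: cong_repr. Qed.

Lemma palg_mulE t u : palg_mul (palg_of t) (palg_of u) = palg_of (t * u).
Proof. by apply/palg_ofP; apply: cong_mul; exact: cong_repr. Qed.

Lemma palg_scaleE a t : palg_scale a (palg_of t) = palg_of (a *: t).
Proof. by apply/palg_ofP/cong_scale/cong_repr. Qed.

Let palgE := (palg_oppE, palg_addE, palg_mulE, palg_scaleE).

Fact palg_addA : associative palg_add.
Proof.
elim/palgW=> t; elim/palgW=> u; elim/palgW=> w.
by rewrite !palgE; apply/palg_ofP; exact: cong_addA.
Qed.
Fact palg_addC : commutative palg_add.
Proof.
elim/palgW=> t; elim/palgW=> u.
by rewrite !palgE; apply/palg_ofP; exact: cong_addC.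
Qed.
Fact palg_add0 : left_id (palg_of 0) palg_add.
Proof.
by elim/palgW=> t; rewrite !palgE; apply/palg_ofP; exact: cong_add0.
Qed.
Fact palg_addN : left_inverse (palg_of 0) palg_opp palg_add.
Proof.
by elim/palgW=> t; rewrite !palgE; apply/palg_ofP; exact: cong_addN.
Qed.

HB.instance Definition _ := GRing.isZmodule.Build palg
  palg_addA palg_addC palg_add0 palg_addN.

Fact palg_mulA : associative palg_mul.
Proof.
elim/palgW=> t; elim/palgW=> u; elim/palgW=> w.
by rewrite !palgE; apply/palg_ofP; exact: cong_mulA.
Qed.
Fact palg_mul1l : left_id (palg_of 1) palg_mul.
Proof.
by elim/palgW=> t; rewrite !palgE; apply/palg_ofP; exact: cong_mul1l.
Qed.
Fact palg_mul1r : right_id (palg_of 1) palg_mul.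
Proof.
by elim/palgW=> t; rewrite !palgE; apply/palg_ofP; exact: cong_mul1r.
Qed.
Fact palg_mulDl : left_distributive palg_mul palg_add.
Proof.
elim/palgW=> t; elim/palgW=> u; elim/palgW=> w.
by rewrite !palgE; apply/palg_ofP; exact: cong_mulDl.
Qed.
Fact palg_mulDr : right_distributive palg_mul palg_add.
Proof.
elim/palgW=> t; elim/palgW=> u; elim/palgW=> w.
by rewrite !palgE; apply/palg_ofP; exact: cong_mulDr.
Qed.

HB.instance Definition _ := GRing.Zmodule_isPzRing.Build palg
  palg_mulA palg_mul1l palg_mul1r palg_mulDl palg_mulDr.

Fact palg_scaleA a b x : palg_scale a (palg_scale b x) = palg_scale (a * b)%R x.
Proof.
by elim/palgW: x => t; rewrite !palgE; apply/palg_ofP; exact: cong_scaleA.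
Qed.
Fact palg_scale1 : left_id 1%R palg_scale.
Proof.
by elim/palgW=> t; rewrite !palgE; apply/palg_ofP; exact: cong_scale1.
Qed.
Fact palg_scaleDr : right_distributive palg_scale +%R.
Proof.
move=> a; elim/palgW=> t; elim/palgW=> u; rewrite /GRing.add /=.
by rewrite !palgE; apply/palg_ofP; exact: cong_scaleDr.
Qed.
Fact palg_scaleDl x : {morph palg_scale^~ x : a b / a + b}%R.
Proof.
move=> a b; elim/palgW: x => t; rewrite [RHS]/GRing.add /=.
by rewrite !palgE; apply/palg_ofP; exact: cong_scaleDl.
Qed.

HB.instance Definition _ := GRing.Zmodule_isLmodule.Build F palg
  palg_scaleA palg_scale1 palg_scaleDr palg_scaleDl.

(* lalgType and algType require 1 != 0, which a presented algebra need not
   satisfy; the algebra structure is palg's pzRingType and lmodType structures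
   together with the following two laws. *)
Lemma palg_scaleAl (a : F) (x y : palg) : (a *: (x * y) = (a *: x) * y)%R.
Proof.
elim/palgW: x => t; elim/palgW: y => u.
rewrite /GRing.scale /GRing.mul /=.
by rewrite !palgE; apply/palg_ofP; exact: cong_scaleAl.
Qed.
Lemma palg_scaleAr (a : F) (x y : palg) : (a *: (x * y) = x * (a *: y))%R.
Proof.
elim/palgW: x => t; elim/palgW: y => u.
rewrite /GRing.scale /GRing.mul /=.
by rewrite !palgE; apply/palg_ofP; exact: cong_scaleAr.
Qed.

End PresentedAlgebra.


Inductive gen : Type :=
| Tau of nat
| E of nat
| X of nat
| Z of nat.

Definition gen_defined (k : nat) (g : gen) : bool :=
  match g with
  | Tau i => 2 <= i <= 2 * k - 1
  | E j => 1 <= j <= 2 * k - 1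
  | X r => 1 <= r <= 2 * k
  | Z _ => true
  end%N.

Definition gens (k : nat) : Type := {g : gen | gen_defined k g}.

Section Relations.
Variables (F : comNzRingType) (k : nat).

Local Notation "'τ' i" := (TGen (Tau i%N) : term F gen) (at level 8, i at level 2).
Local Notation "'e' i" := (TGen (E i%N) : term F gen) (at level 8, i at level 2).
Local Notation "'x' i" := (TGen (X i%N) : term F gen) (at level 8, i at level 2).
Local Notation "'z' l" := (TGen (Z l%N) : term F gen) (at level 8, l at level 2).
Local Notation s j := (τ (2*j) * τ (2*j+1) + e (2*j))%palg.
Reserved Notation "t === u" (at level 70, no associativity).

(* Relations between expressions in generators with arbitrary indices; only
   those all of whose generators are defined are imposed, see affine_rel. In
   particular a truncated index such as 2 * i - 2 = 0 yields no relation. *)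
Inductive raw_rel : term F gen -> term F gen -> Prop :=
| rel_tau_even_sq i : (1 <= i <= k - 1)%N ->
    τ (2*i) * τ (2*i) === 1 - e (2*i)
| rel_tau_odd_sq i : (1 <= i <= k - 1)%N ->
    τ (2*i+1) * τ (2*i+1) === 1 - e (2*i)
| rel_tau_odd_even (i j : nat) : j != (i + 1)%N ->
    τ (2*i+1) * τ (2*j) === τ (2*j) * τ (2*i+1)
| rel_tau_odd_odd (i j : nat) : j != (i - 1)%N -> j != (i + 1)%N ->
    τ (2*i+1) * τ (2*j+1) === τ (2*j+1) * τ (2*i+1)
| rel_tau_even_even (i j : nat) : j != (i - 1)%N -> j != (i + 1)%N ->
    τ (2*i) * τ (2*j) === τ (2*j) * τ (2*i)
| rel_braid i : (1 <= i <= k - 2)%N ->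
    s i * s (i+1) * s i === s (i+1) * s i * s (i+1)
| rel_e_odd_sq i : (1 <= i <= k)%N ->
    e (2*i-1) * e (2*i-1) === z 0 * e (2*i-1)
| rel_e_even_sq i : (1 <= i <= k - 1)%N ->
    e (2*i) * e (2*i) === e (2*i)
| rel_tau_odd_e i : (1 <= i <= k - 1)%N ->
    τ (2*i+1) * e (2*i) === 0
| rel_e_tau_odd i : (1 <= i <= k - 1)%N ->
    e (2*i) * τ (2*i+1) === 0
| rel_tau_even_e i : (1 <= i <= k - 1)%N ->
    τ (2*i) * e (2*i) === 0
| rel_e_tau_even i : (1 <= i <= k - 1)%N ->
    e (2*i) * τ (2*i) === 0
| rel_tau_e_e i : (1 <= i <= k - 1)%N ->
    τ (2*i) * e (2*i-1) * e (2*i+1) === τ (2*i+1) * e (2*i-1) * e (2*i+1)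
| rel_e_e_tau i : (1 <= i <= k - 1)%N ->
    e (2*i+1) * e (2*i-1) * τ (2*i) === e (2*i+1) * e (2*i-1) * τ (2*i+1)
| rel_e_e (i j : nat) : ((i + 2 <= j) || (j + 2 <= i))%N ->
    e i * e j === e j * e i
| rel_tau_odd_e_odd (i j : nat) : j != (i - 1)%N -> j != i ->
    τ (2*i-1) * e (2*j-1) === e (2*j-1) * τ (2*i-1)
| rel_tau_odd_e_even (i j : nat) : j != i ->
    τ (2*i-1) * e (2*j) === e (2*j) * τ (2*i-1)
| rel_tau_even_e_odd (i j : nat) : j != i -> j != (i + 1)%N ->
    τ (2*i) * e (2*j-1) === e (2*j-1) * τ (2*i)
| rel_tau_even_e_even (i j : nat) : j != (i - 1)%N ->
    τ (2*i) * e (2*j) === e (2*j) * τ (2*i)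
| rel_TL_up i : (1 <= i <= 2 * k - 2)%N ->
    e i * e (i+1) * e i === e i
| rel_TL_down i : (1 <= i <= 2 * k - 2)%N ->
    e (i+1) * e i * e (i+1) === e (i+1)
| rel_tau_e_odd_tau i : (1 <= i <= k - 1)%N ->
    τ (2*i) * e (2*i-1) * τ (2*i) === τ (2*i+1) * e (2*i+1) * τ (2*i+1)
| rel_tau_e_even_tau i : (2 <= i <= k - 1)%N ->
    τ (2*i) * e (2*i-2) * τ (2*i) === τ (2*i-1) * e (2*i) * τ (2*i-1)
| rel_x_x (i j : nat) :
    x i * x j === x j * x i
| rel_tau_x (i j : nat) : j != (i - 1)%N -> j != i -> j != (i + 1)%N ->
    τ i * x j === x j * τ i
| rel_e_x (i j : nat) : j != i -> j != (i + 1)%N ->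
    e i * x j === x j * e i
| rel_braid_even i :
    τ (2*i-2) * τ (2*i) * τ (2*i-2)
      === τ (2*i) * τ (2*i-2) * τ (2*i) * (1 - e (2*i-2))
| rel_braid_odd i :
    τ (2*i+1) * τ (2*i-1) * τ (2*i+1)
      === τ (2*i-1) * τ (2*i+1) * τ (2*i-1) * (1 - e (2*i))
| rel_tau_oeo i :
    τ (2*i-1) * τ (2*i) * τ (2*i-1)
      === τ (2*i) - e (2*i-2) * τ (2*i) - τ (2*i) * e (2*i-2)
| rel_tau_eoe i :
    τ (2*i) * τ (2*i-1) * τ (2*i)
      === τ (2*i-1) - e (2*i) * τ (2*i-1) - τ (2*i-1) * e (2*i)
| rel_x_rec_odd i :
    x (2*i+1) === τ (2*i) * x (2*i-1) * τ (2*i) + e (2*i) * e (2*i-1) * τ (2*i)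
                  + τ (2*i) * e (2*i-1) * e (2*i) - τ (2*i)
| rel_x_rec_even i :
    x (2*i+2) === τ (2*i+1) * x (2*i) * τ (2*i+1)
                  + e (2*i) * e (2*i+1) * τ (2*i+1) * e (2*i+1) * e (2*i)
                  + τ (2*i+1)
| rel_x_self_even i :
    x (2*i) === τ (2*i) * x (2*i) * τ (2*i) + e (2*i) * e (2*i-1) * τ (2*i)
                + τ (2*i) * e (2*i-1) * e (2*i)
| rel_x_self_odd i :
    x (2*i+1) === τ (2*i+1) * x (2*i+1) * τ (2*i+1)
                  + e (2*i) * e (2*i+1) * τ (2*i+1)
                  + τ (2*i+1) * e (2*i+1) * e (2*i)
| rel_e_anti i : (1 <= i <= 2 * k - 1)%N ->
    e i * (x i - x (i+1)) === 0
| rel_anti_e i : (1 <= i <= 2 * k - 1)%N ->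
    (x i - x (i+1)) * e i === 0
| rel_e_xl_e l : (1 <= l)%N ->
    e 1 * x 1 ^+ l * e 1 === z l * e 1
| rel_z_central l t :
    z l * t === t * z l
where "t === u" := (raw_rel t%palg u%palg).

Definition affine_rel (t u : term F (gens k)) : Prop :=
  raw_rel (tmap sval t) (tmap sval u).

(* The generators are indexed up to 2k, so this is A_{2k}^aff. *)
Definition affine_partition_algebra : Type := palg affine_rel.
HB.instance Definition _ := GRing.PzRing.on affine_partition_algebra.
HB.instance Definition _ := GRing.Lmodule.on affine_partition_algebra.

(* The junk value 0 is only used for indices outside the range of the family. *)
Definition affine_gen (g : gen) : affine_partition_algebra :=
  if insub g is Some g' then palg_gen affine_rel (g' : gens k) else 0.

End Relations.

(* Vectors are rows and permutations act on the right of rows. Since s * t means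
   "s, then t" for permutations, v |-> v *m rM s is a left action of S(n) with
   the usual composition of permutations, and a mx_representation of 'S_n of
   degree d is a CS(n)-module with basis m_1, ..., m_d.
   The indices 1..n and 1..k are represented by 'I_n and 'I_k, i.e. shifted
   by 1. *)

Section PermutationModule.
Variables (F : fieldType) (n : nat).

Local Notation S := [set: 'S_n]%G.

Definition pbasis (a : 'I_n) : 'rV[F]_n := delta_mx 0 a.

Definition pact (s : 'S_n) (v : 'rV[F]_n) : 'rV[F]_n := v *m perm_mx s.

Lemma pact_pbasis (s : 'S_n) (a : 'I_n) : pact s (pbasis a) = pbasis (s a).
Proof. by apply/rowP=> b; rewrite /pact /pbasis -rowE !mxE eqxx eq_sym. Qed.

(* The elements T_{n,b} and Z_{n,l} of the group algebra, which is realized by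
   the matrices of the regular representation. *)
Definition Tsum (b : 'I_n) : 'M[F]_#|S| :=
  \sum_(a | a != b) regular_repr F S (tperm a b).

Definition Zsum (l : nat) : 'M[F]_#|S| := \sum_b Tsum b ^+ l.

End PermutationModule.

Section TensorSpace.
Variables (F : fieldType) (n k d : nat).
Variable rM : mx_representation F [set: 'S_n] d.

Local Notation M := 'rV[F]_d.
Local Notation V := 'rV[F]_n.

(* M ⊗ V^{⊗k} is the direct sum of copies of M indexed by the basis v_a of
   V^{⊗k}: w represents the sum over a of w a ⊗ v_a. *)
Definition tspace : Type := {ffun {ffun 'I_k -> 'I_n} -> M}.
HB.instance Definition _ := Vector.on tspace.

Definition tens (m : M) (w : 'I_k -> V) : tspace :=
  [ffun a : {ffun 'I_k -> 'I_n} => (\prod_i w i 0 (a i)) *: m].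

Definition vtens (m : M) (a : {ffun 'I_k -> 'I_n}) : tspace :=
  tens m (fun i => pbasis F (a i)).

(* s (m ⊗ w_1 ⊗ ... ⊗ w_j) ⊗ w_{j+1} ⊗ ... ⊗ w_k *)
Definition bracket_act (s : 'S_n) (j : nat) (m : M) (w : 'I_k -> V) : tspace :=
  tens (m *m rM s) (fun i => if (i < j)%N then pact s (w i) else w i).

(* s (m ⊗ v_a) = s m ⊗ s v_{a_1} ⊗ ... ⊗ s v_{a_k}, extended linearly *)
Definition diag_act (s : 'S_n) (t : tspace) : tspace :=
  \sum_a bracket_act s k (t a) (fun i => pbasis F (a i)).

Lemma tens_linear (w : 'I_k -> V) : linear (tens^~ w).
Proof.
move=> c m m'; apply/ffunP=> a.
by rewrite !ffunE scalerDr !scalerA mulrC.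
Qed.

Fact diag_act_linear (s : 'S_n) : linear (diag_act s).
Proof.
move=> c t u; rewrite /diag_act scaler_sumr -big_split; apply: eq_bigr => a _.
by rewrite /bracket_act !ffunE mulmxDl -scalemxAl tens_linear.
Qed.
HB.instance Definition _ (s : 'S_n) :=
  GRing.isLinear.Build F tspace tspace _ (diag_act s) (diag_act_linear s).

Lemma sum_vtens (t : tspace) : t = \sum_a vtens (t a) a.
Proof.
apply/ffunP=> b; rewrite sum_ffunE (bigD1 b) //= big1 => [|a ab].
  rewrite ffunE big1 ?scale1r ?addr0 // => i _.
  by rewrite /pbasis mxE !eqxx.
rewrite ffunE; case: (altP (a =P b)) => [eq_ab | neq_ab].
  by rewrite eq_ab eqxx in ab.
have [i ai] : exists i, a i != b i.
  apply/existsP; rewrite -negb_forall; apply: contra neq_ab => /forallP eqab.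
  by apply/eqP/ffunP=> i; apply/eqP.
by rewrite (bigD1 i) //= /pbasis mxE eqxx /= eq_sym (negbTE ai) mul0r scale0r.
Qed.

Lemma diag_act_tens (s : 'S_n) (m : M) (w : 'I_k -> V) :
  diag_act s (tens m w) = tens (m *m rM s) (fun i => pact s (w i)).
Proof.
pose sa (a : {ffun 'I_k -> 'I_n}) := [ffun i => s (a i)].
pose si (a : {ffun 'I_k -> 'I_n}) := [ffun i => (s^-1)%g (a i)].
have saK : cancel sa si by move=> a; apply/ffunP=> i; rewrite !ffunE permK.
have siK : cancel si sa by move=> a; apply/ffunP=> i; rewrite !ffunE permKV.
rewrite [RHS]sum_vtens /diag_act [RHS](reindex sa); last by exists si => a _.
apply: eq_bigr => a _; rewrite /vtens /bracket_act !ffunE -scalemxAl.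
congr (tens (_ *: _) _).
  apply: eq_bigr => i _; rewrite ffunE /pact.
  rewrite mxE (bigD1 (a i)) //= !mxE eqxx mulr1 big1 ?addr0 // => j ja.
  by rewrite !mxE (inj_eq perm_inj) (negbTE ja) mulr0.
by apply: funext => i; rewrite ltn_ord pact_pbasis ffunE.
Qed.

Definition commutes_Sn : {pred 'End(tspace)} := fun f =>
  [forall s : 'S_n, (f \o linfun (diag_act s) == linfun (diag_act s) \o f)%VF].

Lemma commutes_SnP (f : 'End(tspace)) :
  reflect (forall s t, f (diag_act s t) = diag_act s (f t)) (f \in commutes_Sn).
Proof.
apply: (iffP forallP) => [fs s t | fs s].
  have /eqP/lfunP/(_ t) := fs s.
  by rewrite !lfunE /= !lfunE.
by apply/eqP/lfunP=> t; rewrite !comp_lfunE !lfunE /= fs.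
Qed.

Fact commutes_Sn_submod : submod_closed commutes_Sn.
Proof.
split=> [|c f g /commutes_SnP fs /commutes_SnP gs]; apply/commutes_SnP => s t.
  by rewrite !lfunE /= linear0.
by rewrite !lfunE /= !lfunE /= fs gs linearP.
Qed.
HB.instance Definition _ :=
  GRing.isSubmodClosed.Build F 'End(tspace) commutes_Sn commutes_Sn_submod.

Record End_Sn : Type := EndSn {
  End_Sn_val :> 'End(tspace);
  _ : End_Sn_val \in commutes_Sn
}.

HB.instance Definition _ := [isSub for End_Sn_val].
HB.instance Definition _ := [Choice of End_Sn by <:].
HB.instance Definition _ := [SubChoice_isSubLmodule of End_Sn by <:].

Fact End_Sn_one_subproof : (\1%VF : 'End(tspace)) \in commutes_Sn.
Proof. by apply/commutes_SnP=> s t; rewrite !id_lfunE. Qed.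
Fact End_Sn_mul_subproof (f g : End_Sn) :
  (val f \o val g)%VF \in commutes_Sn.
Proof.
apply/commutes_SnP=> s t; rewrite !comp_lfunE.
by rewrite (commutes_SnP _ (valP g)) (commutes_SnP _ (valP f)).
Qed.

Definition End_Sn_one : End_Sn := EndSn End_Sn_one_subproof.
Definition End_Sn_mul (f g : End_Sn) : End_Sn := EndSn (End_Sn_mul_subproof f g).

Fact End_Sn_mulA : associative End_Sn_mul.
Proof. by move=> f g h; apply: val_inj; exact: comp_lfunA. Qed.
Fact End_Sn_mul1l : left_id End_Sn_one End_Sn_mul.
Proof. by move=> f; apply: val_inj; exact: comp_lfun1l. Qed.
Fact End_Sn_mul1r : right_id End_Sn_one End_Sn_mul.
Proof. by move=> f; apply: val_inj; exact: comp_lfun1r. Qed.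
Fact End_Sn_mulDl : left_distributive End_Sn_mul +%R.
Proof. by move=> f g h; apply: val_inj; exact: comp_lfunDl. Qed.
Fact End_Sn_mulDr : right_distributive End_Sn_mul +%R.
Proof. by move=> f g h; apply: val_inj; exact: comp_lfunDr. Qed.

HB.instance Definition _ := GRing.Zmodule_isPzRing.Build End_Sn
  End_Sn_mulA End_Sn_mul1l End_Sn_mul1r End_Sn_mulDl End_Sn_mulDr.

(* As for palg, no algType instance since End_Sn is the zero ring if d = 0. *)
Lemma End_Sn_scaleAl (c : F) (f g : End_Sn) : c *: (f * g) = (c *: f) * g.
Proof. by apply: val_inj; rewrite /= comp_lfunZl. Qed.
Lemma End_Sn_scaleAr (c : F) (f g : End_Sn) : c *: (f * g) = f * (c *: g).
Proof. by apply: val_inj; rewrite /= comp_lfunZr. Qed.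

End TensorSpace.

(* Main.v *)
(** Encode a vector of M ⊗ V^{⊗k} by its coefficient function f, defined on words w
   (infinite ones, of which only the first k letters matter), with values in M. In these
   coordinates each of τ_i, e_{2i}, x_r sends f to w |-> \sum_s s (f (s w)), where s runs
   over a set of involutions that is read off from w and acts only on a prefix of w, and
   e_{2i-1} sums f over the letter in position i. Two operators of the first kind commute
   when the letters read by one are, for the prefix moved by the other, either all inside
   (use equivariance) or all outside. This settles the commutation relations, while
   the remaining relations involve at most three consecutive letters and follow by
   comparing coefficients, according to which of these letters coincide. *)

Require Import Defs.
From HB Require Import structures.
From mathcomp Require Import all_boot all_order all_algebra all_fingroup.
From mathcomp Require Import mxrepresentation generic_quotient boolp reals complex.
From mathcomp Require Import zify.

Set Implicit Arguments.
Unset Strict Implicit.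
Unset Printing Implicit Defensive.

Import GRing.Theory.

Local Open Scope ring_scope.

(** * Operators on module-valued functions of words *)

Section Operators.
Variables (F : comNzRingType) (n : nat) (V : lmodType F) (L : 'S_n -> {linear V -> V}).
Hypothesis L1 : forall v, L 1%g v = v.
Hypothesis LM : forall s t v, L (s * t)%g v = L s (L t v).

Definition word := nat -> 'I_n.
Implicit Types (f : word -> V) (w : word) (s t : 'S_n) (b : 'I_n) (i j p : nat).

Definition pre j s w : word := fun r => if (r < j)%N then s (w r) else w r.
Definition upd p b w : word := fun r => if r == p then b else w r.

(** As [s * t] means s first, the order in [LM] makes [prefix_act j] multiplicative: acting by t and
    then by s is acting by [s * t]. *)
Definition prefix_act j s f w : V := L s (f (pre j s w)).
Definition prefix_sum j (A : word -> pred 'S_n) f w : V :=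
  \sum_(s | A w s) prefix_act j s f w.

(** Sums over letters are recast as sums over sets of permutations, which can be reindexed by
    conjugation. *)
Definition tau_set p w : pred 'S_n :=
  fun s => (w p != w p.+1) && (s == tperm (w p) (w p.+1)).
Definition x_set p w : pred 'S_n :=
  fun s => [exists b, (b != w p) && (s == tperm b (w p))].

(* With positions counted from 0 and p = i - 1, the generators τ_{2i}, τ_{2i+1}, x_{2i-1},
   x_{2i}, e_{2i}, e_{2i-1} are [tau_op p p], [tau_op p.+2 p], [x_op p p], [x_op p.+1 p],
   [diag_op p], [sum_op p]. *)
Definition tau_op j p f w : V :=
  if w p == w p.+1 then 0 else prefix_act j (tperm (w p) (w p.+1)) f w.
Definition x_op j p f w : V :=
  \sum_(b | b != w p) prefix_act j (tperm b (w p)) f w.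
Definition diag_op p f w : V := if w p == w p.+1 then f w else 0.
Definition sum_op p f w : V := \sum_b f (upd p b w).

Lemma sum_tau_set p w (G : 'S_n -> V) :
  \sum_(s | tau_set p w s) G s = if w p == w p.+1 then 0 else G (tperm (w p) (w p.+1)).
Proof.
by rewrite /tau_set; case: ifP => _ /=; [rewrite big_pred0 | rewrite big_pred1_eq].
Qed.

Lemma sum_x_set p w (G : 'S_n -> V) :
  \sum_(s | x_set p w s) G s = \sum_(b | b != w p) G (tperm b (w p)).
Proof.
rewrite (reindex_onto (fun b => tperm b (w p)) (fun s : 'S_n => s (w p))) /=.
  apply: eq_bigl => b; rewrite tpermR eqxx andbT /x_set.
  apply/existsP/idP => [[c /andP[cw /eqP E]]|bw]; last by exists b; rewrite bw eqxx.
  by have := congr1 (fun s : 'S_n => s (w p)) E; rewrite !tpermR => ->.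
by move=> s /existsP[b /andP[_ /eqP->]]; rewrite tpermR.
Qed.

Lemma tau_opE j p : tau_op j p = prefix_sum j (tau_set p).
Proof.
by apply/funext=> f; apply/funext=> w; rewrite /prefix_sum sum_tau_set.
Qed.

Lemma x_opE j p : x_op j p = prefix_sum j (x_set p).
Proof.
by apply/funext=> f; apply/funext=> w; rewrite /prefix_sum sum_x_set.
Qed.

Lemma pre1 j w : pre j 1%g w = w.
Proof. by apply/funext=> r; rewrite /pre perm1 if_same. Qed.

(** Only the identity is summed, so the prefix length j is free; [diag_comm] adapts it to the other
    operator. *)
Lemma diag_opE j p :
  diag_op p = prefix_sum j (fun w s => (w p == w p.+1) && (s == 1%g)).
Proof.
apply/funext=> f; apply/funext=> w; rewrite /diag_op /prefix_sum.
by case: eqP => _ /=; [rewrite big_pred1_eq /prefix_act L1 pre1 | rewrite big_pred0].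
Qed.

(** * Commuting operators *)

(** Both sides are double sums over s in [A w] and t in [B w], once the inner index on the right is
    written as [s ^ t]; they agree because [s * t = t * s ^ t]. *)
Lemma prefix_sum_comm i j (A B : word -> pred 'S_n) :
    (i <= j)%N ->
    (forall w s, A w s -> B (pre i s w) =1 B w) ->
    (forall w t s, B w t -> A (pre j t w) (s ^ t)%g = A w s) ->
  forall f w, prefix_sum i A (prefix_sum j B f) w = prefix_sum j B (prefix_sum i A f) w.
Proof.
move=> ij Binv Aeqv f w; rewrite /prefix_sum /prefix_act.
under eq_bigr => s As.
  rewrite linear_sum (eq_bigl _ _ (Binv _ _ As)).
  over.
under [RHS]eq_bigr => t Bt.
  rewrite linear_sum (reindex_inj (conjg_inj t)) /=.
  rewrite (eq_bigl _ _ (Aeqv _ _ ^~ Bt)).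
  over.
rewrite exchange_big /=; apply: eq_bigr => t Bt; apply: eq_bigr => s As.
rewrite -!LM -conjgC; congr (L _ (f _)); apply/funext=> r; rewrite /pre.
(* Letters before i are moved by both permutations, the others at most by t. *)
case: (ltnP r i) => ri; last by [].
by rewrite (leq_trans ri ij) -!permM -conjgC.
Qed.

Definition local l h (A : word -> pred 'S_n) : Prop := forall w w' t s,
  (forall r, (l <= r < h)%N -> w' r = t (w r)) -> A w' (s ^ t)%g = A w s.

Lemma tau_set_local p : local p p.+2 (tau_set p).
Proof.
move=> w w' t s E; rewrite /tau_set !E ?leqnn ?leqnSn //= (inj_eq perm_inj) -tpermJ.
by rewrite (inj_eq (conjg_inj t)).
Qed.

Lemma x_set_local p : local p p.+1 (x_set p).
Proof.
move=> w w' t s E; rewrite /x_set !E ?leqnn //=.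
apply/existsP/existsP => [] [b /andP[bw /eqP Es]].
  exists (t^-1%g b); rewrite -(inj_eq (@perm_inj _ t)) permKV bw.
  by rewrite -(inj_eq (conjg_inj t)) tpermJ permKV Es eqxx.
by exists (t b); rewrite (inj_eq perm_inj) bw Es tpermJ eqxx.
Qed.

(** The shorter operator moves no letter read by B, and the longer one moves every letter read by A,
    which conjugates A. *)
Lemma local_comm i j l h l' h' A B :
    local l h A -> local l' h' B -> (i <= j)%N -> (h <= j)%N -> (i <= l')%N ->
  forall f w, prefix_sum i A (prefix_sum j B f) w = prefix_sum j B (prefix_sum i A f) w.
Proof.
move=> Al Bl ij hj il; apply: prefix_sum_comm => // [w s _ t | w t s _].
  rewrite -[t in LHS]conjg1; apply: Bl => r /andP[lr _].
  by rewrite perm1 /pre ltnNge (leq_trans il lr).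
by apply: Al => r /andP[_ rh]; rewrite /pre (leq_trans rh hj).
Qed.

(** The two compared letters are either both fixed or both moved by the same permutation. The
    identity is given the longer prefix in the first case and the empty one in the second. *)
Lemma diag_comm j l h A p :
    local l h A -> (j <= p)%N || (p.+2 <= j)%N ->
  forall f w, prefix_sum j A (diag_op p f) w = diag_op p (prefix_sum j A f) w.
Proof.
move=> Al /orP[jp | pj] f w.
  rewrite (diag_opE (j + h)); apply: prefix_sum_comm; first exact: leq_addr.
    by move=> {}w s _ t; rewrite /pre !ltnNge jp (leq_trans jp (leqnSn _)).
  move=> {}w t s /andP[_ /eqP->]; apply: Al => r /andP[_ rh].
  by rewrite pre1 perm1.
rewrite (diag_opE 0); apply/esym/prefix_sum_comm => //.
move=> {}w t s _; rewrite /pre pj (ltnW pj) (inj_eq perm_inj).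
by rewrite -[in RHS](inj_eq (conjg_inj t)) conj1g.
Qed.

(** A does not read the summed letter, and a permutation moving that letter only reorders the
    sum. *)
Lemma sum_comm j l h A p : local l h A -> (p < l)%N || (h <= p)%N ->
  forall f w, prefix_sum j A (sum_op p f) w = sum_op p (prefix_sum j A f) w.
Proof.
move=> Al lph f w; rewrite /prefix_sum /sum_op /prefix_act.
under eq_bigr do rewrite linear_sum.
rewrite exchange_big /=.
have AE b : A (upd p b w) =1 A w.
  move=> s; rewrite -[s in LHS]conjg1; apply: Al => r rlh.
  by rewrite perm1 /upd ifF //; lia.
under [RHS]eq_bigr do rewrite (eq_bigl _ _ (AE _)).
rewrite exchange_big [RHS]exchange_big /=; apply: eq_bigr => s As.
case: (ltnP p j) => pj.
  rewrite (reindex_inj (@perm_inj _ s)); apply: eq_bigr => b _.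
  congr (L _ (f _)); apply/funext=> r; rewrite /upd /pre.
  by case: eqP => [->|//]; rewrite pj.
apply: eq_bigr => b _.
congr (L _ (f _)); apply/funext=> r; rewrite /upd /pre.
by case: eqP => [->|//]; rewrite ltnNge pj.
Qed.

Lemma sum_diagC p q f w : p != q -> p != q.+1 ->
  sum_op p (diag_op q f) w = diag_op q (sum_op p f) w.
Proof.
move=> pq pq1; rewrite /sum_op /diag_op /upd eq_sym (negbTE pq) eq_sym (negbTE pq1).
by case: ifP => // _; rewrite big1.
Qed.

Lemma sum_sumC p q f w : p != q ->
  sum_op p (sum_op q f) w = sum_op q (sum_op p f) w.
Proof.
move=> pq; rewrite /sum_op exchange_big; apply: eq_bigr => b _; apply: eq_bigr => c _.
congr f; apply/funext=> r; rewrite /upd.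
by case: eqP => [->|//]; rewrite eq_sym (negbTE pq).
Qed.

Lemma diag_diagC p q f w : diag_op p (diag_op q f) w = diag_op q (diag_op p f) w.
Proof. by rewrite /diag_op; do !case: ifP. Qed.

(** * Relations between neighbouring positions *)

Ltac pos := rewrite /pre /upd; repeat match goal with
  | |- context [(?a < ?b)%N] =>
      (have -> : (a < b)%N = true by lia) || (have -> : (a < b)%N = false by lia)
  | |- context [@eq_op ?T ?a ?b] => match type of a with nat => idtac end;
      (have -> : (@eq_op T a b) = true by lia) || (have -> : (@eq_op T a b) = false by lia)
  end.

Ltac perm_cases := do ?case: tpermP; congruence.

Ltac word_eq p := apply/funext => r; rewrite /pre /upd;
  (have [?|[?|[?|[?|?]]]] :
    (r < p)%N \/ r = p \/ r = p.+1 \/ r = p.+2 \/ (p.+2 < r)%N by lia);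
  subst; pos; perm_cases.

Ltac perm_eq := apply/permP => ?; rewrite ?permM ?perm1; perm_cases.

(** Terms have the form [L s (f w')], so it suffices to compare the permutations s and the words w'
    pointwise. *)
Ltac act_eq f p := rewrite -?LM; congr (L _ (f _)); first [solve [perm_eq] | solve [word_eq p]].

(** The two letters stay put for j = p and are exchanged for j = p.+2; either way the second
    transposition equals the first and cancels it. *)
Lemma tau_sq j p f w : (j == p) || (j == p.+2) ->
  tau_op j p (tau_op j p f) w = f w - diag_op p f w.
Proof.
rewrite /tau_op /diag_op /prefix_act => jp.
case: eqP => ab; first by rewrite subrr.
rewrite subr0 -[f w]L1.
case/orP: jp => /eqP->; pos; rewrite ?tpermL ?tpermR.
  case: eqP => // _; act_eq f p.
case: eqP => [|_]; first by perm_cases.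
act_eq f p.
Qed.

Lemma tau_diag j p f w : (j == p) || (j == p.+2) -> tau_op j p (diag_op p f) w = 0.
Proof.
rewrite /tau_op /diag_op /prefix_act => jp.
case: eqP => // ab; rewrite ifF ?linear0 //.
case/orP: jp => /eqP->; pos; rewrite ?tpermL ?tpermR; case: eqP; congruence.
Qed.

Lemma diag_tau j p f w : diag_op p (tau_op j p f) w = 0.
Proof. by rewrite /tau_op /diag_op; case: ifP => // ->. Qed.

Lemma sum_sq p f w : sum_op p (sum_op p f) w = sum_op p f w *+ n.
Proof.
rewrite -[in RHS](card_ord n) -sumr_const /sum_op; apply: eq_bigr => b _.
by apply: eq_bigr => c _; congr f; word_eq p.
Qed.

Lemma diag_idem p f w : diag_op p (diag_op p f) w = diag_op p f w.
Proof. by rewrite /diag_op; case: ifP => // ->. Qed.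

Lemma tau_sum_sum p f w :
  tau_op p p (sum_op p (sum_op p.+1 f)) w =
  tau_op p.+2 p (sum_op p (sum_op p.+1 f)) w.
Proof.
rewrite /tau_op; case: ifP => // _; rewrite /prefix_act /sum_op.
congr (L _ _); apply: eq_bigr => b _; apply: eq_bigr => c _; congr f; word_eq p.
Qed.

(** [tau_op p.+2 p] exchanges the two summed letters and [tau_op p p] does not; exchanging the
    summation variables makes up for this. *)
Lemma sum_sum_tau p f w :
  sum_op p.+1 (sum_op p (tau_op p p f)) w =
  sum_op p.+1 (sum_op p (tau_op p.+2 p f)) w.
Proof.
rewrite /sum_op [RHS]exchange_big; apply: eq_bigr => b _; apply: eq_bigr => c _.
rewrite /tau_op /prefix_act; pos; rewrite eq_sym; case: eqP => // bc.
act_eq f p.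
Qed.

(** The element s_i of the presentation, which by [swap_opE] merely exchanges two neighbouring
    tensor factors. *)
Definition swap_op p f w :=
  tau_op p p (tau_op p.+2 p f) w + diag_op p f w.

Lemma swap_opE p f w :
  swap_op p f w = f (fun r => w (if r == p then p.+1 else if r == p.+1 then p else r)).
Proof.
rewrite /swap_op /tau_op /diag_op /prefix_act; case: eqP => ab.
  by rewrite add0r; congr f; word_eq p.
rewrite addr0; pos; rewrite ifF; last by case: eqP.
by rewrite -[RHS]L1; act_eq f p.
Qed.

Lemma swap_braid p f w :
  swap_op p (swap_op p.+1 (swap_op p f)) w =
  swap_op p.+1 (swap_op p (swap_op p.+1 f)) w.
Proof. rewrite !swap_opE; congr f; word_eq p. Qed.

(** The equality test leaves one term, in which a letter is replaced by its neighbour. The relations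
    e_i e_{i+1} e_i = e_i thereby become equalities of words. *)
Lemma sum_diagE p f w : sum_op p (diag_op p f) w = f (upd p (w p.+1) w).
Proof.
rewrite /sum_op /diag_op; under eq_bigr do pos.
by rewrite -big_mkcond big_pred1_eq.
Qed.

Lemma sumS_diagE p f w : sum_op p.+1 (diag_op p f) w = f (upd p.+1 (w p) w).
Proof.
rewrite /sum_op /diag_op; under eq_bigr => b _ do (pos; rewrite eq_sym).
by rewrite -big_mkcond big_pred1_eq.
Qed.

Lemma sum_diag_sum p f w : sum_op p (diag_op p (sum_op p f)) w = sum_op p f w.
Proof.
by rewrite sum_diagE /sum_op; apply: eq_bigr => b _; congr f; word_eq p.
Qed.

Lemma diag_sum_diag p f w : diag_op p (sum_op p (diag_op p f)) w = diag_op p f w.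
Proof.
by rewrite {1 3}/diag_op sum_diagE; case: eqP => // ab; congr f; word_eq p.
Qed.

Lemma diag_sumS_diag p f w : diag_op p (sum_op p.+1 (diag_op p f)) w = diag_op p f w.
Proof.
by rewrite {1 3}/diag_op sumS_diagE; case: eqP => // ab; congr f; word_eq p.
Qed.

Lemma sumS_diag_sumS p f w :
  sum_op p.+1 (diag_op p (sum_op p.+1 f)) w = sum_op p.+1 f w.
Proof.
by rewrite sumS_diagE /sum_op; apply: eq_bigr => b _; congr f; word_eq p.
Qed.

(** For letters x, y in positions p, p.+1, both sides sum over b distinct from y the terms with
    transpositions (x,y) and (y,b) and final letters b, y. *)
Lemma tau_sum_tau p f w :
  tau_op p p (sum_op p (tau_op p p f)) w =
  tau_op p.+2 p (sum_op p.+1 (tau_op p.+2 p f)) w.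
Proof.
rewrite /tau_op /sum_op /prefix_act; case: eqP => // ab.
rewrite !linear_sum; apply: eq_bigr => b _; pos; rewrite !tpermL eq_sym.
by case: eqP => bc; [rewrite !linear0 | act_eq f p].
Qed.

Ltac absurd_values := exfalso; repeat match goal with
  | H : context [fun_of_perm (tperm ?x ?y) ?z] |- _ =>
      move: H; case: (tpermP x y z) => *
  end; congruence.

(** A transposition is evaluated only at an argument free of other transpositions, and contradictory
    cases are dropped at once. *)
Ltac value_cases := repeat (pos; rewrite ?tpermL ?tpermR;
  match goal with
  | |- context [fun_of_perm (tperm ?x ?y) ?z] =>
      lazymatch z with
      | context [tperm] => fail
      | _ => case: (tpermP x y z) => *; try absurd_values
      end
  | |- context [if @eq_op _ ?x ?y then _ else _] =>
      case: (@eqP _ x y) => ?; try absurd_values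
  end); rewrite ?(subr0, addr0, subrr, linear0, oppr0).

(** On the right the summed letter b is also changed into the letter c of the transposition;
    exchanging b and c matches the double sums. *)
Lemma sum_x p f w : sum_op p (x_op p p f) w = sum_op p (x_op p.+1 p f) w.
Proof.
rewrite /sum_op /x_op.
under eq_bigr do (rewrite big_mkcond; pos).
under [RHS]eq_bigr do (rewrite big_mkcond; pos).
rewrite exchange_big; apply: eq_bigr => b _; apply: eq_bigr => c _.
rewrite /= eq_sym; case: ifP => // _; rewrite /prefix_act tpermC; act_eq f p.
Qed.

Lemma x_sum p f w : x_op p p (sum_op p f) w = x_op p.+1 p (sum_op p f) w.
Proof.
apply: eq_bigr => b _; rewrite /prefix_act /sum_op; congr (L _ _).
by apply: eq_bigr => c _; congr f; word_eq p.
Qed.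

Lemma diag_x p f w : diag_op p (x_op p.+1 p f) w = diag_op p (x_op p.+1 p.+1 f) w.
Proof. by rewrite /diag_op /x_op; case: eqP => // ->. Qed.

(** For distinct letters in positions p and p.+1, the equality test on the transformed word leaves
    on both sides only the transposition of these two letters. *)
Lemma x_diag p f w : x_op p.+1 p (diag_op p f) w = x_op p.+1 p.+1 (diag_op p f) w.
Proof.
rewrite /x_op /prefix_act /diag_op; pos.
case: (w p =P w p.+1) => [-> // | ab].
rewrite (bigD1 (w p.+1)) /=; last by apply/eqP => ba; apply: ab.
rewrite [RHS](bigD1 (w p)) /=; last by apply/eqP.
pos; rewrite !tpermL !tpermR !eqxx tpermC big1 => [|b /andP[_ bq]].
  rewrite big1 // => b /andP[_ /eqP bp]; pos; case: eqP; last by rewrite linear0.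
  by case: tpermP; congruence.
by pos; rewrite tpermR (negbTE bq) linear0.
Qed.

(* If [w p != w p.+1], then of the terms [prefix_act p.+1 (tperm b (w p.+1))] on the left
   only the one with [b = w p] moves the letter in position [p]; the last two summands on
   the right correct for it. *)
Lemma x_rec_odd p f w :
  x_op p.+1 p.+1 f w = tau_op p p (x_op p p (tau_op p p f)) w
    + diag_op p (sum_op p (tau_op p p f)) w + tau_op p p (sum_op p (diag_op p f)) w
    - tau_op p p f w.
Proof.
rewrite /x_op /diag_op /tau_op -/(diag_op p); case: eqP => ab.
  rewrite add0r addr0 subr0 big_mkcond; apply: eq_bigr => b _.
  rewrite /prefix_act; pos; rewrite -ab; case: eqP => //= _; act_eq f p.
rewrite addr0 /prefix_act sum_diagE linear_sum.
(* For x = [w p], y = [w p.+1] and b' the image of b under (x,y), one has (x,y)(b,x)(x,y) = (b',y);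
   this substitution matches the index on the left. *)
rewrite [in RHS](reindex_inj (@perm_inj _ (tperm (w p) (w p.+1)))) /=.
rewrite (bigD1 (w p)) /=; last by apply/eqP.
rewrite [in RHS](bigD1 (w p)) /=; last by pos; rewrite tpermL; apply/eqP => ba; apply: ab.
(* Here z is [tau_op p p f w]: it is the term split off on the right, and the last summand cancels
   it. *)
have aux (x y z : V) : x + y = z + y + x - z.
  by rewrite (addrC z) addrAC addrK addrC.
apply: etrans (aux _ _ (prefix_act p (tperm (w p) (w p.+1)) f w)) _.
congr (_ + _ + _ - _); last by act_eq f p.
  pos; rewrite tpermL; case: eqP => // _; rewrite /prefix_act; act_eq f p.
apply: eq_big => b.
  by pos; case: tpermP => [->|->|/eqP bp /eqP bq]; rewrite ?eqxx ?andbF ?bp ?bq.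
move=> /andP[/eqP bq /eqP bp]; rewrite /prefix_act; value_cases; act_eq f p.
Qed.

(** For distinct letters x, y in positions p, p.+1 and b different from both, (x,y)(b,y)(b,x) =
    (b,y). The inner [tau_op] kills b = x on the right; the last summand restores it. *)
Lemma x_rec_even p f w :
  x_op p.+2 p.+1 f w = tau_op p.+2 p (x_op p.+1 p (tau_op p.+2 p f)) w
    + diag_op p (sum_op p.+1 (tau_op p.+2 p (sum_op p.+1 (diag_op p f)))) w
    + tau_op p.+2 p f w.
Proof.
rewrite /x_op /diag_op /tau_op -/(diag_op p); case: eqP => ab.
  rewrite add0r addr0 big_mkcond; apply: eq_bigr => b _.
  rewrite /prefix_act sumS_diagE; pos; rewrite -ab eq_sym.
  by case: eqP => //= _; act_eq f p.
rewrite addr0 /prefix_act (bigD1 (w p)) /=; last by apply/eqP.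
rewrite addrC; congr (_ + _).
rewrite linear_sum [RHS](bigD1 (w p)) /=; last by pos; rewrite tpermL; apply/eqP.
pos; rewrite tpermL tpermR eqxx !linear0 add0r; apply: eq_bigr => b /andP[/eqP bq /eqP bp].
value_cases; act_eq f p.
Qed.

(** Here (x,y)(b,x)(b,y) = (b,x), and the term b = y killed by the inner [tau_op] is the last
    summand. *)
Lemma x_self_even p f w :
  x_op p.+1 p f w = tau_op p p (x_op p.+1 p (tau_op p p f)) w
    + diag_op p (sum_op p (tau_op p p f)) w + tau_op p p (sum_op p (diag_op p f)) w.
Proof.
rewrite /x_op /diag_op /tau_op -/(diag_op p); case: eqP => ab.
  rewrite add0r addr0 big_mkcond; apply: eq_bigr => b _.
  rewrite /prefix_act; pos; rewrite -ab; case: eqP => //= _; act_eq f p.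
have ba : w p.+1 != w p by apply/eqP => ba; apply: ab.
rewrite addr0 addrC (bigD1 (w p.+1)) //= /prefix_act sum_diagE; congr (_ + _).
  by pos; rewrite tpermC; act_eq f p.
rewrite linear_sum [RHS](bigD1 (w p.+1)) /=; last by pos.
pos; rewrite tpermR eqxx !linear0 add0r; apply: eq_bigr => b /andP[/eqP bp /eqP bq].
value_cases; act_eq f p.
Qed.

(** Here (x,y)(b,x)(x,y) = (b,y). The inner [tau_op] kills b = y on the right, and the term b = x on
    the left is the last summand. *)
Lemma x_self_odd p f w :
  x_op p.+1 p.+1 f w = tau_op p.+2 p (x_op p.+1 p.+1 (tau_op p.+2 p f)) w
    + diag_op p (sum_op p.+1 (tau_op p.+2 p f)) w
    + tau_op p.+2 p (sum_op p.+1 (diag_op p f)) w.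
Proof.
rewrite /x_op /diag_op /tau_op -/(diag_op p); case: eqP => ab.
  rewrite add0r addr0 big_mkcond; apply: eq_bigr => b _.
  rewrite /prefix_act; pos; rewrite -ab eq_sym; case: eqP => //= _; act_eq f p.
have ba : w p != w p.+1 by apply/eqP.
rewrite addr0 addrC (bigD1 (w p)) //= /prefix_act sumS_diagE; congr (_ + _).
  by pos; act_eq f p.
rewrite linear_sum [RHS](bigD1 (w p.+1)) /=; last by pos; rewrite tpermR eq_sym.
pos; rewrite !(tpermL, tpermR) eqxx !linear0 add0r.
apply: eq_big => [b|b /andP[/eqP bq /eqP bp]]; first by rewrite andbC.
value_cases; act_eq f p.
Qed.

(** In this and the next four relations, fixing which of three consecutive letters coincide leaves
    at most one term on each side after cancellation. *)
Lemma tau_diag_tau p f w :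
  tau_op p.+1 p.+1 (diag_op p (tau_op p.+1 p.+1 f)) w =
  tau_op p.+2 p (diag_op p.+1 (tau_op p.+2 p f)) w.
Proof.
rewrite /tau_op /diag_op /prefix_act; value_cases => //; act_eq f p.
Qed.

Lemma tau_braid_even p f w :
  tau_op p p (tau_op p.+1 p.+1 (tau_op p p f)) w =
  tau_op p.+1 p.+1 (tau_op p p (tau_op p.+1 p.+1 (fun u => f u - diag_op p f u))) w.
Proof.
rewrite /tau_op /diag_op /prefix_act; value_cases => //; act_eq f p.
Qed.

Lemma tau_braid_odd p f w :
  tau_op p.+3 p.+1 (tau_op p.+2 p (tau_op p.+3 p.+1 f)) w =
  tau_op p.+2 p (tau_op p.+3 p.+1 (tau_op p.+2 p (fun u => f u - diag_op p.+1 f u))) w.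
Proof.
rewrite /tau_op /diag_op /prefix_act; value_cases => //; act_eq f p.
Qed.

Lemma tau_odd_even_odd p f w :
  tau_op p.+2 p (tau_op p.+1 p.+1 (tau_op p.+2 p f)) w =
  tau_op p.+1 p.+1 f w - diag_op p (tau_op p.+1 p.+1 f) w
    - tau_op p.+1 p.+1 (diag_op p f) w.
Proof.
rewrite /tau_op /diag_op /prefix_act; value_cases => //; act_eq f p.
Qed.

Lemma tau_even_odd_even p f w :
  tau_op p.+1 p.+1 (tau_op p.+2 p (tau_op p.+1 p.+1 f)) w =
  tau_op p.+2 p f w - diag_op p.+1 (tau_op p.+2 p f) w
    - tau_op p.+2 p (diag_op p.+1 f) w.
Proof.
rewrite /tau_op /diag_op /prefix_act; value_cases => //; act_eq f p.
Qed.

(** * Evaluation of expressions in the generators *)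

(** With [zeta], the actions of T_{n,b} and Z_{n,l} without the group algebra; [zeta_gring] gives
    the link. *)
Definition class_act b (v : V) : V := \sum_(a | a != b) L (tperm a b) v.
Definition zeta l (v : V) : V := \sum_b iter l (class_act b) v.

Fact class_act_linear b : linear (class_act b).
Proof.
move=> a u v; rewrite /class_act scaler_sumr -big_split.
by apply: eq_bigr => c _; rewrite linearP.
Qed.
HB.instance Definition _ b := GRing.isLinear.Build F V V _ (class_act b) (class_act_linear b).

Lemma iter_class_act_linear l b : linear (iter l (class_act b)).
Proof. by elim: l => // l IHl a u v; rewrite /= IHl linearP. Qed.

Fact zeta_linear l : linear (zeta l).
Proof.
move=> a u v; rewrite /zeta scaler_sumr -big_split.
by apply: eq_bigr => c _; exact: iter_class_act_linear.
Qed.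
HB.instance Definition _ l := GRing.isLinear.Build F V V _ (zeta l) (zeta_linear l).

Lemma class_actL b s v : class_act b (L s v) = L s (class_act (s b) v).
Proof.
rewrite /class_act linear_sum [RHS](reindex_inj (@perm_inj _ s)).
apply: eq_big => [a|a _]; first by rewrite (inj_eq perm_inj).
by rewrite -!LM -tpermJ -conjgC.
Qed.

(** Conjugation by s permutes the elements T_{n,b}, hence the terms of Z_{n,l}. *)
Lemma zetaL l s v : zeta l (L s v) = L s (zeta l v).
Proof.
rewrite /zeta linear_sum [RHS](reindex_inj (@perm_inj _ s)); apply: eq_bigr => b _.
by elim: l => //= l ->; rewrite class_actL.
Qed.

Lemma zeta0 v : zeta 0 v = v *+ n.
Proof. by rewrite /zeta sumr_const card_ord. Qed.

(** The prefix moved by x_1 is empty, so the word stays fixed and only the module is acted on. *)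
Lemma iter_x0 l f w : iter l (x_op 0 0) f w = iter l (class_act (w 0)) (f w).
Proof. by elim: l w => //= l IHl w; apply: eq_bigr => b _; rewrite /prefix_act IHl. Qed.

Lemma sum_x_sum l f w :
  sum_op 0 (iter l (x_op 0 0) (sum_op 0 f)) w = zeta l (sum_op 0 f w).
Proof.
apply: eq_bigr => b _; rewrite iter_x0; congr (iter _ _ _).
by rewrite /sum_op; apply: eq_bigr => c _; congr (f _); word_eq 0%N.
Qed.

(** For τ the indices 2p+2 and 2p+3 share the position p, whereas for e and x the indices 2p+1 and
    2p+2 do. *)
Definition gen_op (g : gen) : (word -> V) -> word -> V :=
  match g with
  | Tau i => tau_op (if odd i then i./2.+1 else i./2.-1) i./2.-1
  | E j => if odd j then sum_op j./2 else diag_op j./2.-1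
  | X r => x_op r./2 r.-1./2
  | Z l => fun f w => zeta l (f w)
  end.

Lemma gen_tau_even i p : i = (2 * p.+1)%N -> gen_op (Tau i) = tau_op p p.
Proof. by move=> Ei /=; congr tau_op; [case: ifP|]; lia. Qed.
Lemma gen_tau_odd i p : i = (2 * p.+1 + 1)%N -> gen_op (Tau i) = tau_op p.+2 p.
Proof. by move=> Ei /=; congr tau_op; [case: ifP|]; lia. Qed.
Lemma gen_e_odd i p : i = (2 * p + 1)%N -> gen_op (E i) = sum_op p.
Proof. by move=> Ei /=; rewrite ifT; [congr sum_op|]; lia. Qed.
Lemma gen_e_even i p : i = (2 * p.+1)%N -> gen_op (E i) = diag_op p.
Proof. by move=> Ei /=; rewrite ifF; [congr diag_op|]; lia. Qed.
Lemma gen_x_odd i p : i = (2 * p + 1)%N -> gen_op (X i) = x_op p p.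
Proof. by move=> Ei /=; congr x_op; lia. Qed.
Lemma gen_x_even i p : i = (2 * p.+1)%N -> gen_op (X i) = x_op p.+1 p.
Proof. by move=> Ei /=; congr x_op; lia. Qed.

Ltac gen_norm p := repeat match goal with
  | |- context [gen_op (Tau ?i)] =>
      (rewrite (@gen_tau_even i p); [|lia]) || (rewrite (@gen_tau_odd i p); [|lia])
  | |- context [gen_op (E ?i)] =>
      (rewrite (@gen_e_even i p); [|lia]) || (rewrite (@gen_e_odd i p); [|lia])
  | |- context [gen_op (X ?i)] =>
      (rewrite (@gen_x_even i p); [|lia]) || (rewrite (@gen_x_odd i p); [|lia])
  end.

Fixpoint eval (t : term F gen) : (word -> V) -> word -> V :=
  match t with
  | TGen g => gen_op g
  | TZero => fun _ _ => 0
  | TOpp t => fun f w => - eval t f w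
  | TAdd t u => fun f w => eval t f w + eval u f w
  | TOne => id
  | TMul t u => fun f => eval t (eval u f)
  | TScale a t => fun f w => a *: eval t f w
  end.

Fixpoint all_gens (P : pred gen) (t : term F gen) : bool :=
  match t with
  | TGen g => P g
  | TZero | TOne => true
  | TOpp t | TScale _ t => all_gens P t
  | TAdd t u | TMul t u => all_gens P t && all_gens P u
  end.

(** Every generator acts through sums of maps [L s], which commute with [zeta l]. *)
Lemma gen_op_zeta l g f w :
  gen_op g (fun u => zeta l (f u)) w = zeta l (gen_op g f w).
Proof.
case: g => [i|j|r|m] /=.
- by rewrite /tau_op /prefix_act; case: ifP; rewrite ?linear0 ?zetaL.
- case: ifP => _; rewrite /sum_op ?linear_sum // /diag_op.
  by case: ifP; rewrite ?linear0.
- by rewrite /x_op /prefix_act linear_sum /=; apply: eq_bigr => b _; rewrite zetaL.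
rewrite [in LHS]/zeta [zeta m _]/zeta linear_sum /=; apply: eq_bigr => b _.
elim: m => //= m ->; rewrite /class_act linear_sum /=.
by apply: eq_bigr => c _; rewrite zetaL.
Qed.

Lemma eval_zeta l (t : term F gen) f w : eval t (fun u => zeta l (f u)) w = zeta l (eval t f w).
Proof.
elim: t f w => [g||t IHt|t IHt u IHu||t IHt u IHu|a t IHt] f w //=.
- exact: gen_op_zeta.
- by rewrite linear0.
- by rewrite IHt raddfN.
- by rewrite IHt IHu raddfD.
- by rewrite -IHt; congr (eval t _ w); apply/funext => v.
by rewrite IHt linearZ.
Qed.

(** * Verification of the defining relations *)

Lemma half_spec i : (0 < i)%N -> exists p, i = (2 * p + 1)%N \/ i = (2 * p.+1)%N.
Proof.
move=> i0; exists (i.-1./2); lia.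
Qed.

Lemma tau_tauC j p j' p' f w : (j <= j')%N -> (p.+2 <= j')%N -> (j <= p')%N ->
  tau_op j p (tau_op j' p' f) w = tau_op j' p' (tau_op j p f) w.
Proof.
by move=> *; rewrite !tau_opE; apply: (local_comm (@tau_set_local _) (@tau_set_local _)).
Qed.

Lemma x_xC j p j' p' f w : (j <= j')%N -> (p.+1 <= j')%N -> (j <= p')%N ->
  x_op j p (x_op j' p' f) w = x_op j' p' (x_op j p f) w.
Proof.
by move=> *; rewrite !x_opE; apply: (local_comm (@x_set_local _) (@x_set_local _)).
Qed.

Lemma tau_xC j p j' p' f w :
    [&& j <= j', p.+2 <= j' & j <= p']%N || [&& j' <= j, p'.+1 <= j & j' <= p]%N ->
  tau_op j p (x_op j' p' f) w = x_op j' p' (tau_op j p f) w.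
Proof.
rewrite tau_opE x_opE; case/orP=> /and3P[? ? ?]; last symmetry.
  exact: (local_comm (@tau_set_local _) (@x_set_local _)).
exact: (local_comm (@x_set_local _) (@tau_set_local _)).
Qed.

Lemma tau_diagC j p q f w : (j <= q)%N || (q.+2 <= j)%N ->
  tau_op j p (diag_op q f) w = diag_op q (tau_op j p f) w.
Proof. by move=> *; rewrite tau_opE; apply: (diag_comm (@tau_set_local _)). Qed.

Lemma x_diagC j p q f w : (j <= q)%N || (q.+2 <= j)%N ->
  x_op j p (diag_op q f) w = diag_op q (x_op j p f) w.
Proof. by move=> *; rewrite x_opE; apply: (diag_comm (@x_set_local _)). Qed.

Lemma tau_sumC j p q f w : (q < p)%N || (p.+2 <= q)%N ->
  tau_op j p (sum_op q f) w = sum_op q (tau_op j p f) w.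
Proof. by move=> *; rewrite tau_opE; apply: (sum_comm _ (@tau_set_local _)). Qed.

Lemma x_sumC j p q f w : (q < p)%N || (p.+1 <= q)%N ->
  x_op j p (sum_op q f) w = sum_op q (x_op j p f) w.
Proof. by move=> *; rewrite x_opE; apply: (sum_comm _ (@x_set_local _)). Qed.

Lemma sum_opB p f g w : sum_op p (fun u => f u - g u) w = sum_op p f w - sum_op p g w.
Proof. by rewrite /sum_op sumrB. Qed.

Lemma diag_opB p f g w : diag_op p (fun u => f u - g u) w = diag_op p f w - diag_op p g w.
Proof. by rewrite /diag_op; case: ifP; rewrite ?subr0. Qed.

Arguments gen_op : simpl never.

Ltac parity i := let q := fresh "q" in
  have [q [?|?]] : exists q, i = (2 * q + 1)%N \/ i = (2 * q.+1)%N by apply: half_spec; lia.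

(** Definedness of the generators excludes truncated indices; shifting the remaining ones to
    positions from 0 turns each relation into one of the lemmas above. *)
Lemma raw_rel_eval k (t u : term F gen) : raw_rel k t u ->
    all_gens (gen_defined k) t -> all_gens (gen_defined k) u ->
  forall f w, eval t f w = eval u f w.
Proof.
case=> {t u}.
- case=> [|p] ? /= ? ? f w; first by lia.
  by gen_norm p; rewrite tau_sq ?eqxx.
- case=> [|p] ? /= ? ? f w; first by lia.
  by gen_norm p; rewrite tau_sq ?eqxx ?orbT.
- move=> [|p] [|q] /= ? ? ? f w; try lia.
  (* [tau_tauC] wants the shorter prefix on the outside, so the relative position decides its
     direction. *)
  gen_norm p; gen_norm q; case: (leqP p.+2 q) => ?; last symmetry;
    apply: tau_tauC; lia.
- move=> [|p] [|q] /= ? ? ? ? f w; try lia.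
  gen_norm p; gen_norm q; case: (ltngtP p q) => [? | ? | ->] //; last symmetry;
    apply: tau_tauC; lia.
- move=> [|p] [|q] /= ? ? ? ? f w; try lia.
  gen_norm p; gen_norm q; case: (ltngtP p q) => [? | ? | ->] //; last symmetry;
    apply: tau_tauC; lia.
- case=> [|p] ? /= ? ? f w; first by lia.
  gen_norm p; gen_norm p.+1; exact: swap_braid.
- case=> [|p] ? /= ? ? f w; first by lia.
  by gen_norm p; rewrite sum_sq /gen_op zeta0.
- case=> [|p] ? /= ? ? f w; first by lia.
  by gen_norm p; exact: diag_idem.
- case=> [|p] ? /= ? ? f w; first by lia.
  by gen_norm p; rewrite tau_diag ?eqxx ?orbT.
- case=> [|p] ? /= ? ? f w; first by lia.
  by gen_norm p; exact: diag_tau.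
- case=> [|p] ? /= ? ? f w; first by lia.
  by gen_norm p; rewrite tau_diag ?eqxx.
- case=> [|p] ? /= ? ? f w; first by lia.
  by gen_norm p; exact: diag_tau.
- case=> [|p] ? /= ? ? f w; first by lia.
  by gen_norm p; gen_norm p.+1; exact: tau_sum_sum.
- case=> [|p] ? /= ? ? f w; first by lia.
  by gen_norm p; gen_norm p.+1; exact: sum_sum_tau.
- move=> i j ? /= ? ? f w; parity i; parity j; gen_norm q; gen_norm q0.
  + apply: sum_sumC; lia.
  + apply: sum_diagC; lia.
  + symmetry; apply: sum_diagC; lia.
  exact: diag_diagC.
(* τ_{2i-1} is defined from i = 2 on and is τ_{2(i-1)+1}, whence i = p.+2. *)
- move=> [|[|p]] [|q] /= ? ? ? ? f w; try lia.
  gen_norm p; gen_norm q; apply: tau_sumC; lia.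
- move=> [|[|p]] [|q] /= ? ? ? f w; try lia.
  gen_norm p; gen_norm q; apply: tau_diagC; lia.
- move=> [|p] [|q] /= ? ? ? ? f w; try lia.
  gen_norm p; gen_norm q; apply: tau_sumC; lia.
- move=> [|p] [|q] /= ? ? ? f w; try lia.
  gen_norm p; gen_norm q; apply: tau_diagC; lia.
- move=> i ? /= ? ? f w; parity i; gen_norm q; gen_norm q.+1.
    exact: sum_diag_sum.
  exact: diag_sumS_diag.
- move=> i ? /= ? ? f w; parity i; gen_norm q; gen_norm q.+1.
    exact: diag_sum_diag.
  exact: sumS_diag_sumS.
- case=> [|p] ? /= ? ? f w; first by lia.
  by gen_norm p; gen_norm p.+1; exact: tau_sum_tau.
- case=> [|[|p]] ? /= ? ? f w; try lia.
  by gen_norm p; gen_norm p.+1; exact: tau_diag_tau.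
- move=> i j /= ? ? f w; parity i; parity j; gen_norm q; gen_norm q0;
    case: (ltngtP q q0) => ?;
    by [apply: x_xC; lia | symmetry; apply: x_xC; lia | subst q0].
(* For odd i = 2q+1, the position of τ_i is [q.-1]. *)
- move=> i j ? ? ? /= ? ? f w; parity i; parity j; gen_norm q0; gen_norm q; gen_norm q.-1;
    apply: tau_xC; lia.
- move=> i j ? ? /= ? ? f w; parity i; parity j; gen_norm q; gen_norm q0; symmetry;
    by [apply: x_sumC; lia | apply: x_diagC; lia].
- case=> [|[|p]] /= ? ? f w; try lia.
  gen_norm p; gen_norm p.+1; exact: tau_braid_even.
- case=> [|[|p]] /= ? ? f w; try lia.
  gen_norm p; gen_norm p.+1; exact: tau_braid_odd.
- case=> [|[|p]] /= ? ? f w; try lia.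
  gen_norm p; gen_norm p.+1; exact: tau_odd_even_odd.
- case=> [|[|p]] /= ? ? f w; try lia.
  gen_norm p; gen_norm p.+1; exact: tau_even_odd_even.
- case=> [|p] /= ? ? f w; first by lia.
  gen_norm p; gen_norm p.+1; exact: x_rec_odd.
- case=> [|p] /= ? ? f w; first by lia.
  gen_norm p; gen_norm p.+1; exact: x_rec_even.
- case=> [|p] /= ? ? f w; first by lia.
  gen_norm p; gen_norm p.+1; exact: x_self_even.
- case=> [|p] /= ? ? f w; first by lia.
  gen_norm p; gen_norm p.+1; exact: x_self_odd.
- move=> i ? /= ? ? f w; parity i; gen_norm q; gen_norm q.+1.
    by rewrite sum_opB sum_x subrr.
  by rewrite diag_opB diag_x subrr.
- move=> i ? /= ? ? f w; parity i; gen_norm q; gen_norm q.+1.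
    by rewrite x_sum subrr.
  by rewrite x_diag subrr.
- move=> l l0 /= _ _ f w; gen_norm 0%N.
  have -> : eval (iter l (TMul (TGen (X 1))) TOne) = iter l (x_op 0 0).
    by elim: l {l0} => //= l ->; gen_norm 0%N.
  exact: sum_x_sum.
by move=> l t /= _ _ f w; exact/esym/eval_zeta.
Qed.

(** * Equivariance, dependence on the first k letters, linearity *)

Lemma gen_op_prefix k g s f w : gen_defined k g ->
  gen_op g (prefix_act k s f) w = prefix_act k s (gen_op g f) w.
Proof.
pose B (_ : word) : pred 'S_n := pred1 s.
have prefixE h v : prefix_act k s h v = prefix_sum k B h v.
  by rewrite /prefix_sum big_pred1_eq.
have -> : prefix_act k s f = prefix_sum k B f by exact/funext.
rewrite prefixE.
(* The action on the whole prefix k is the longer operator and moves all letters that A reads. *)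
have localC j l h A : local l h A -> (j <= k)%N -> (h <= k)%N ->
    prefix_sum j A (prefix_sum k B f) w = prefix_sum k B (prefix_sum j A f) w.
  move=> Al jk hk; apply: prefix_sum_comm => // v t r _; apply: Al => i /andP[_ ih].
  by rewrite /pre (leq_trans ih hk).
case: g => [i|j|r|l] /= gk; rewrite /gen_op.
- rewrite !tau_opE; apply: (localC _ _ _ _ (@tau_set_local _)); last lia.
  by case: ifP; lia.
- rewrite -prefixE; case: ifP => oj.
    rewrite /prefix_act /sum_op linear_sum [RHS](reindex_inj (@perm_inj _ s)).
    apply: eq_bigr => b _; rewrite -prefixE /prefix_act; congr (L _ (f _)).
    apply/funext => r; rewrite /pre /upd; case: (r =P j./2) => [->|//].
    by rewrite ifT //; lia.
  rewrite /diag_op -prefixE /prefix_act; pos.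
  by rewrite (inj_eq perm_inj); case: ifP; rewrite ?linear0.
- rewrite !x_opE; apply: (localC _ _ _ _ (@x_set_local _)); lia.
by rewrite -!prefixE /prefix_act zetaL.
Qed.

Lemma gen_op_eq k g f :
    (forall w w', (forall r, (r < k)%N -> w r = w' r) -> f w = f w') ->
    gen_defined k g ->
  forall w w', (forall r, (r < k)%N -> w r = w' r) -> gen_op g f w = gen_op g f w'.
Proof.
move=> fk gk w w' ww'.
have preE j s : f (pre j s w) = f (pre j s w').
  by apply: fk => r rk; rewrite /pre; case: ifP => _; rewrite ww'.
case: g gk => [i|j|r|l] /= gk; rewrite /gen_op.
- rewrite /tau_op /prefix_act preE (ww' i./2.-1) ?(ww' i./2.-1.+1) //; lia.
- case: ifP => oj; last first.
    by rewrite /diag_op (fk _ _ ww') (ww' j./2.-1) ?(ww' j./2.-1.+1) //; lia.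
  by apply: eq_bigr => b _; apply: fk => r rk; rewrite /upd; case: ifP => _; rewrite ?ww'.
- rewrite /x_op ww'; last by lia.
  by apply: eq_bigr => b _; rewrite /prefix_act preE.
by rewrite (fk _ _ ww').
Qed.

Lemma gen_op_linear g c f h w :
  gen_op g (fun u => c *: f u + h u) w = c *: gen_op g f w + gen_op g h w.
Proof.
case: g => [i|j|r|l]; rewrite /gen_op.
- rewrite /tau_op; case: ifP => _; first by rewrite scaler0 addr0.
  by rewrite /prefix_act linearP.
- case: ifP => _; last by rewrite /diag_op; case: ifP; rewrite // scaler0 addr0.
  by rewrite /sum_op scaler_sumr -big_split.
- rewrite /x_op scaler_sumr -big_split; apply: eq_bigr => b _.
  by rewrite /prefix_act linearP.
by rewrite linearP.
Qed.

End Operators.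

(** * The action on the tensor space *)

Section TensorAction.
Variables (F : fieldType) (n k' d : nat).
Local Notation k := k'.+1.
Variable rM : mx_representation F [set: 'S_n] d.

Local Notation M := 'rV[F]_d.
Local Notation T := (tspace F n k d).
Local Notation index := {ffun 'I_k -> 'I_n}.
Implicit Types (t : T) (a b : index) (m : M) (w : word n).

(* The inverse makes up for words being transformed covariantly in [prefix_act]. *)
Definition inv_act (s : 'S_n) : {linear M -> M} := mulmxr (rM s^-1%g).

Lemma inv_act1 m : inv_act 1%g m = m.
Proof. by rewrite /= invg1 repr_mx1 mulmx1. Qed.

Lemma inv_actM s r m : inv_act (s * r)%g m = inv_act s (inv_act r m).
Proof. by rewrite /= invMg repr_mxM ?inE // mulmxA. Qed.

Definition restr w : index := [ffun i : 'I_k => w i].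
(** Positions from k on receive the first letter, the default of [inord]. *)
Definition ext a : word n := fun r => a (inord r).
Definition extf t : word n -> M := fun w => t (restr w).

Lemma extK a : restr (ext a) = a.
Proof. by apply/ffunP=> i; rewrite ffunE /ext inord_val. Qed.

Lemma extE a (i : 'I_k) : ext a i = a i.
Proof. by rewrite /ext inord_val. Qed.

Lemma eq_extf t w w' : (forall r, (r < k)%N -> w r = w' r) -> extf t w = extf t w'.
Proof.
by move=> ww'; congr (t _); apply/ffunP => i; rewrite !ffunE ww'.
Qed.

Lemma extf_inj : injective extf.
Proof.
move=> t t' E; apply/ffunP => a; rewrite -[a]extK.
by have := congr1 (@^~ (ext a)) E.
Qed.

Definition gen_map g t : T := [ffun a => gen_op inv_act g (extf t) (ext a)].

(** This lets compositions be computed on words, where the relations were proved. *)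
Lemma extf_gen_map g t : gen_defined k g ->
  extf (gen_map g t) = gen_op inv_act g (extf t).
Proof.
move=> gk; apply/funext => w; rewrite [LHS]ffunE.
apply: (gen_op_eq _ (@eq_extf t) gk) => r rk.
by rewrite /ext ffunE inordK.
Qed.

Fact gen_map_linear g : linear (gen_map g).
Proof.
move=> c t u; apply/ffunP => a; rewrite !ffunE -gen_op_linear.
by congr gen_op; apply/funext => w; rewrite /extf !ffunE.
Qed.
HB.instance Definition _ g := GRing.isLinear.Build F T T _ (gen_map g) (gen_map_linear g).

Lemma vtensE m a b : vtens m a b = if a == b then m else 0.
Proof.
rewrite ffunE; case: eqP => [-> | /eqP ab].
  by rewrite big1 ?scale1r // => i _; rewrite mxE !eqxx.
suff [i /negbTE abi] : exists i, a i != b i.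
  by rewrite (bigD1 i) //= mxE eq_sym abi andbF mul0r scale0r.
apply/existsP; apply: contraNT ab; rewrite negb_exists => /forallP ab.
by apply/eqP/ffunP => i; apply/eqP; have := ab i; rewrite negbK.
Qed.

Lemma ext_restr w r : (r < k)%N -> ext (restr w) r = w r.
Proof. by move=> rk; rewrite /ext ffunE inordK. Qed.

Definition bracket_index j (s : 'S_n) a : index := restr (pre j s (ext a)).

Lemma bracket_indexK j s : cancel (bracket_index j s) (bracket_index j s^-1%g).
Proof.
move=> a; apply/ffunP => i; rewrite ffunE {1}/pre !ext_restr // /pre extE.
by case: (i < j)%N; rewrite ?permK.
Qed.

Lemma bracket_indexKV j s : cancel (bracket_index j s^-1%g) (bracket_index j s).
Proof. by rewrite -{2}[s]invgK; exact: bracket_indexK. Qed.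

Lemma bracket_vtens s j m a :
  bracket_act rM s j m (fun i => pbasis F (a i)) = vtens (m *m rM s) (bracket_index j s a).
Proof.
rewrite /bracket_act /vtens; congr tens; apply/funext => i.
by rewrite ffunE /pre extE; case: ifP; rewrite ?pact_pbasis.
Qed.

(** The coefficient of s t at w is s applied to the coefficient of t at s^{-1} w. *)
Lemma diag_actE s t : extf (diag_act rM s t) = prefix_act inv_act k s^-1%g (extf t).
Proof.
apply/funext => w; rewrite /extf /prefix_act /diag_act sum_ffunE /= invgK.
under eq_bigr do rewrite bracket_vtens vtensE.
rewrite (bigD1 (restr (pre k s^-1%g w))) //= big1 => [|a]; last first.
  move=> /eqP ne; case: eqP => // E; case: ne; rewrite -[a](bracket_indexK k s) E.
  by apply/ffunP => i; rewrite [LHS]ffunE [RHS]ffunE /pre ext_restr.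
rewrite ifT ?addr0 //; apply/eqP/ffunP => i.
by rewrite [LHS]ffunE [RHS]ffunE /pre ext_restr ltn_ord ?permKV.
Qed.

Lemma gen_map_commutes (g : gens k) :
  linfun (gen_map (sval g)) \in commutes_Sn rM.
Proof.
apply/commutes_SnP => s t; rewrite !lfunE /=; apply: extf_inj.
rewrite extf_gen_map ?(valP g) // !diag_actE extf_gen_map ?(valP g) //.
by apply/funext => w; rewrite (gen_op_prefix inv_actM) ?(valP g).
Qed.

(** * The algebra homomorphism *)

Fixpoint tens_eval (t : term F (gens k)) : End_Sn k rM :=
  match t with
  | TGen g => EndSn (gen_map_commutes g)
  | TZero => 0
  | TOpp t => - tens_eval t
  | TAdd t u => tens_eval t + tens_eval u
  | TOne => 1
  | TMul t u => tens_eval t * tens_eval u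
  | TScale c t => c *: tens_eval t
  end.

Lemma extf_tens_eval (t : term F (gens k)) (x : T) :
  extf (tens_eval t x) = eval inv_act (tmap sval t) (extf x).
Proof.
elim: t x => [g||t IHt|t IHt u IHu||t IHt u IHu|c t IHt] x /=.
- by rewrite lfunE /= extf_gen_map ?(valP g).
- by apply/funext => w; rewrite lfunE /extf ffunE.
- by rewrite -IHt; apply/funext => w; rewrite lfunE /= /extf !ffunE.
- by rewrite -IHt -IHu; apply/funext => w; rewrite lfunE /= /extf !ffunE.
- by rewrite id_lfunE.
- by rewrite comp_lfunE IHt IHu.
by rewrite -IHt; apply/funext => w; rewrite lfunE /= /extf !ffunE.
Qed.

Lemma all_gens_tmap (t : term F (gens k)) : all_gens (gen_defined k) (tmap sval t).
Proof. by elim: t => //= [g|t -> u ->|t -> u ->] //; exact: valP g. Qed.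

Lemma tens_eval_cong (t u : term F (gens k)) :
  cong (@affine_rel F k) t u -> tens_eval t = tens_eval u.
Proof.
elim=> {t u} //=.
- move=> t u tu; apply/val_inj/lfunP => x; apply: extf_inj.
  rewrite !extf_tens_eval; apply/funext => w.
  exact: (raw_rel_eval inv_act1 inv_actM tu (all_gens_tmap _) (all_gens_tmap _)).
- by move=> t u w _ -> _ ->.
- by move=> t t' _ ->.
- by move=> t t' u u' _ -> _ ->.
- by move=> t t' u u' _ -> _ ->.
- by move=> c t t' _ ->.
- by move=> *; rewrite addrA.
- by move=> *; rewrite addrC.
- by move=> *; rewrite add0r.
- by move=> *; rewrite addNr.
- by move=> *; rewrite mulrA.
- by move=> *; rewrite mul1r.
- by move=> *; rewrite mulr1.
- by move=> *; rewrite mulrDl.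
- by move=> *; rewrite mulrDr.
- by move=> *; rewrite scalerA.
- by move=> *; rewrite scale1r.
- by move=> *; rewrite scalerDr.
- by move=> *; rewrite scalerDl.
- by move=> *; rewrite End_Sn_scaleAl.
by move=> *; rewrite End_Sn_scaleAr.
Qed.

(** By [tens_eval_cong] the value does not depend on the chosen representative. *)
Definition tens_action (x : affine_partition_algebra F k) : End_Sn k rM :=
  tens_eval (repr x).

Lemma tens_actionE (t : term F (gens k)) :
  tens_action (palg_of (@affine_rel F k) t) = tens_eval t.
Proof. exact/tens_eval_cong/cong_repr. Qed.

Fact tens_action_zmod : zmod_morphism tens_action.
Proof.
elim/palgW=> t; elim/palgW=> u.
by rewrite [palg_of _ t - _]/GRing.add /= [- _]/GRing.opp /= palg_oppE palg_addE !tens_actionE.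
Qed.
Fact tens_action_monoid : monoid_morphism tens_action.
Proof.
split; first exact: (tens_actionE TOne).
elim/palgW=> t; elim/palgW=> u.
by rewrite [_ * _ in LHS]/GRing.mul /= palg_mulE !tens_actionE.
Qed.
HB.instance Definition _ := GRing.isZmodMorphism.Build
  (affine_partition_algebra F k) (End_Sn k rM) tens_action tens_action_zmod.
HB.instance Definition _ := GRing.isMonoidMorphism.Build
  (affine_partition_algebra F k) (End_Sn k rM) tens_action tens_action_monoid.

Lemma tens_action_scalable : scalable tens_action.
Proof.
move=> c; elim/palgW=> t.
by rewrite [c *: _ in LHS]/GRing.scale /= palg_scaleE !tens_actionE.
Qed.

Lemma tens_action_gen g (x : T) : gen_defined k g ->
  tens_action (affine_gen F k g) x = gen_map g x.
Proof.
move=> gk; rewrite /affine_gen insubT /palg_gen tens_actionE /=.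
by rewrite lfunE.
Qed.

(** * Values on basis vectors *)

Lemma local_bracket j l h A s b : local l h A -> (h <= k)%N -> (j <= l)%N || (h <= j)%N ->
  A (ext (bracket_index j s b)) s = A (ext b) s.
Proof.
move=> Al hk /orP[jl | hj].
  rewrite -[s in LHS]conjg1; apply: Al => r /andP[lr rh].
  by rewrite ext_restr ?(leq_trans rh hk) // perm1 /pre ltnNge (leq_trans jl lr).
(* Now s moves all letters read by A, and conjugation by s fixes s. *)
have ss : (s ^ s)%g = s by rewrite conjgE mulKg.
rewrite -[X in A _ X = _]ss; apply: Al => r /andP[lr rh].
by rewrite ext_restr ?(leq_trans rh hk) // /pre (leq_trans rh hj).
Qed.

(** The operators read permutations off the target index b, the formulas to be proved read them off
    the source index a. Inversion passes between the two, and the hypothesis matches the sets. *)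
Lemma prefix_sum_vtens j A m a :
    (forall b s, A (ext (bracket_index j s b)) s^-1%g = A (ext b) s) ->
  [ffun b => prefix_sum inv_act j A (extf (vtens m a)) (ext b)] =
  \sum_(s | A (ext a) s) bracket_act rM s j m (fun i => pbasis F (a i)) :> T.
Proof.
move=> Ainv; apply/ffunP => b; rewrite ffunE sum_ffunE /prefix_sum.
rewrite [RHS](reindex_inj invg_inj) big_mkcond [RHS]big_mkcond; apply: eq_bigr => s _.
rewrite bracket_vtens vtensE /prefix_act /extf vtensE -/(bracket_index j s b).
have -> : (bracket_index j s^-1%g a == b) = (a == bracket_index j s b).
  by apply/eqP/eqP => [<-|->]; rewrite ?bracket_indexK ?bracket_indexKV.
case: eqP => [->|_]; first by rewrite Ainv.
by rewrite linear0 !if_same.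
Qed.

Lemma tau_setV p w s : tau_set p w s^-1%g = tau_set p w s.
Proof. by rewrite /tau_set -[s^-1%g == _](inj_eq invg_inj) invgK tpermV. Qed.

Lemma x_setV p w s : x_set p w s^-1%g = x_set p w s.
Proof.
by rewrite /x_set; apply: eq_existsb => b; rewrite -[s^-1%g == _](inj_eq invg_inj) invgK tpermV.
Qed.

Lemma gen_map_tau g j (p q : 'I_k) m a :
    gen_op inv_act g = tau_op inv_act j p -> q = p.+1 :> nat ->
    (j == p) || (j == p.+2) ->
  gen_map g (vtens m a) = (a p != a q)%:R *:
    bracket_act rM (tperm (a p) (a q)) j m (fun i => pbasis F (a i)).
Proof.
move=> gE qp jp; rewrite /gen_map gE tau_opE prefix_sum_vtens => [|b s].
  rewrite sum_tau_set -qp !extE; case: ifP => _; first by rewrite scale0r.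
  by rewrite scale1r.
rewrite tau_setV; apply: local_bracket; first exact: tau_set_local.
  by rewrite -qp.
by case/orP: jp => /eqP->; rewrite leqnn ?orbT.
Qed.

Lemma gen_map_x g j (p : 'I_k) m a :
    gen_op inv_act g = x_op inv_act j p -> (j == p) || (j == p.+1) ->
  gen_map g (vtens m a) =
  \sum_(b | b != a p) bracket_act rM (tperm b (a p)) j m (fun i => pbasis F (a i)).
Proof.
move=> gE jp; rewrite /gen_map gE x_opE prefix_sum_vtens => [|b s].
  by rewrite sum_x_set !extE.
rewrite x_setV; apply: local_bracket; first exact: x_set_local.
  exact: ltn_ord.
by case/orP: jp => /eqP->; rewrite leqnn ?orbT.
Qed.

Lemma gen_map_diag g (p q : 'I_k) m a :
    gen_op inv_act g = diag_op p -> q = p.+1 :> nat ->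
  gen_map g (vtens m a) = (a p == a q)%:R *: vtens m a.
Proof.
move=> gE qp; apply/ffunP => b; rewrite ffunE [RHS]ffunE gE /diag_op /extf extK.
rewrite -qp !extE vtensE; case: (a =P b) => [->|_]; last by rewrite scaler0 if_same.
by case: ifP; rewrite ?scale1r ?scale0r.
Qed.

Lemma gen_map_sum g (p : 'I_k) m a : gen_op inv_act g = sum_op p ->
  gen_map g (vtens m a) =
  \sum_c tens m (fun i => if i == p then pbasis F c else pbasis F (a i)).
Proof.
move=> gE; apply/ffunP => b; rewrite ffunE sum_ffunE gE.
pose updi (c : 'I_n) (e : index) : index := [ffun i => if i == p then c else e i].
have tensE c :
    tens m (fun i => if i == p then pbasis F c else pbasis F (a i)) = vtens m (updi c a).
  by congr tens; apply/funext => i; rewrite ffunE; case: ifP.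
have restrE c : restr (upd p c (ext b)) = updi c b.
  by apply/ffunP => i; rewrite !ffunE /upd extE.
under [RHS]eq_bigr do rewrite tensE vtensE.
rewrite /sum_op /extf; under [LHS]eq_bigr do rewrite restrE vtensE.
have updK c e e' : updi c e = e' -> updi (e p) e' = e.
  by move=> <-; apply/ffunP => i; rewrite !ffunE; case: eqP => // ->.
(* Only c = [a p] contributes on the left and only c = [b p] on the right; both conditions say that
   a and b agree outside p. *)
rewrite (bigD1 (a p)) //= big1 ?addr0 => [|c /negbTE cp]; last first.
  by case: eqP => // E; rewrite E ffunE eqxx eqxx in cp.
rewrite (bigD1 (b p)) //= big1 ?addr0 => [|c /negbTE cp]; last first.
  by case: eqP => // E; rewrite -E ffunE eqxx eqxx in cp.
congr (if _ then _ else _); apply/eqP/eqP => [E | E].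
  by rewrite -{2}(updK _ _ _ (esym E)).
by rewrite -{1}(updK _ _ _ E).
Qed.

Lemma class_act_gring (b : 'I_n) m : class_act inv_act b m = m *m gring_op rM (Tsum F b).
Proof.
rewrite /class_act /Tsum linear_sum mulmx_sumr; apply: eq_bigr => a _.
by rewrite -[X in m *m X]/(gring_op rM _) gring_opG ?inE //= tpermV.
Qed.

(** [gring_opJ] needs its right factor in this form to make [gring_op] multiplicative. *)
Lemma Tsum_gring (b : 'I_n) : exists c, Tsum F b = gring_mx (regular_repr F [set: 'S_n]) c.
Proof.
exists (gring_row (Tsum F b)); rewrite /Tsum linear_sum linear_sum /=; apply: eq_bigr => a _.
by rewrite -gring_opE gring_opG ?inE.
Qed.

Lemma iter_class_act_gring l (b : 'I_n) m :
  iter l (class_act inv_act b) m = m *m gring_op rM (Tsum F b ^+ l).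
Proof.
elim: l => [|l IHl]; first by rewrite expr0 gring_op1 mulmx1.
have [c Tc] := Tsum_gring b.
have -> : Tsum F b ^+ l.+1 = Tsum F b ^+ l *m gring_mx (regular_repr F [set: 'S_n]) c.
  by rewrite -Tc exprSr.
by rewrite iterS IHl class_act_gring gring_opJ -gring_op_mx -Tc mulmxA.
Qed.

Lemma zeta_gring l m : zeta inv_act l m = m *m gring_op rM (Zsum F n l).
Proof.
rewrite /zeta /Zsum linear_sum mulmx_sumr; apply: eq_bigr => b _.
exact: iter_class_act_gring.
Qed.

Lemma gen_map_z l m a :
  gen_map (Z l) (vtens m a) = vtens (m *m gring_op rM (Zsum F n l)) a.
Proof.
apply/ffunP => b; rewrite ffunE /gen_op /extf extK !vtensE zeta_gring.
by case: ifP; rewrite ?mul0mx.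
Qed.

End TensorAction.

Theorem theorem3p3p2 (R : realType) (n k d : nat) (hn : (1 <= n)%N)
    (hk : (1 <= k)%N) (rM : mx_representation R[i] [set: 'S_n] d) :
  exists psi : {rmorphism affine_partition_algebra R[i] k -> End_Sn k rM},
    scalable psi /\
    forall (m : 'rV[R[i]]_d) (a : {ffun 'I_k -> 'I_n}),
    let v t := pbasis R[i] (a t) in
    (* p and q : 'I_k stand for the positions p.+1 and q.+1 among 1, ..., k *)
    (forall p : 'I_k,
      psi (affine_gen R[i] k (E (2 * p.+1 - 1))) (tens m v)
        = \sum_(b < n) tens m (fun t => if t == p then pbasis R[i] b else v t)) /\
    (forall p q : 'I_k, q = p.+1 :> nat ->
      [/\ psi (affine_gen R[i] k (E (2 * p.+1))) (tens m v)
            = (a p == a q)%:R *: tens m v,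
          psi (affine_gen R[i] k (Tau (2 * p.+1))) (tens m v)
            = (a p != a q)%:R *: bracket_act rM (tperm (a p) (a q)) p m v
        & psi (affine_gen R[i] k (Tau (2 * p.+1 + 1))) (tens m v)
            = (a p != a q)%:R *: bracket_act rM (tperm (a p) (a q)) p.+2 m v]) /\
    (forall p : 'I_k,
      psi (affine_gen R[i] k (X (2 * p.+1 - 1))) (tens m v)
        = \sum_(b | b != a p) bracket_act rM (tperm b (a p)) p m v /\
      psi (affine_gen R[i] k (X (2 * p.+1))) (tens m v)
        = \sum_(b | b != a p) bracket_act rM (tperm b (a p)) p.+1 m v) /\
    (forall l : nat,
      psi (affine_gen R[i] k (Z l)) (tens m v)
        = tens (m *m gring_op rM (Zsum R[i] n l)) v).
Proof.
case: k hk rM => // k' _ rM; exists (tens_action rM); split.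
  exact: tens_action_scalable.
move=> m a v; rewrite -/(vtens m a); split=> [p|].
  have pk := ltn_ord p; rewrite tens_action_gen /=; last by lia.
  by apply: gen_map_sum; apply: gen_e_odd; lia.
split=> [p q qp|].
  have qk := ltn_ord q; split; rewrite tens_action_gen /=; try lia.
  - by apply: gen_map_diag => //; exact: gen_e_even.
  - by apply: gen_map_tau; rewrite ?eqxx //; exact: gen_tau_even.
  by apply: gen_map_tau; rewrite ?eqxx ?orbT //; exact: gen_tau_odd.
split=> [p|l]; last by rewrite tens_action_gen // gen_map_z.
have pk := ltn_ord p; split; rewrite tens_action_gen /=; try lia.
  by apply: gen_map_x; rewrite ?eqxx //; apply: gen_x_odd; lia.
by apply: gen_map_x; rewrite ?eqxx ?orbT //; exact: gen_x_even.
Qed.
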